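(* Let $\mathcal N$ be a nest on a complex, infinite dimensional, separable Hilbert space $\mathfrak H$. If $\mathcal N$ satisfies any one of the following three properties, then $\operatorname{ltsr}(\mathcal T(\mathcal N))=\operatorname{rtsr}(\mathcal T(\mathcal N))=\infty$: (a) $\mathcal N$ has an infinite dimensional atom; (b) $\mathcal N$ is uncountable; (c) $\mathcal N$ is countable, but is not order isomorphic to an ordinal or its dual.
   Context: For a unital Banach algebra $\mathcal A$ and $n\ge1$, $Lg_n(\mathcal A)$ is the set of $(a_1,\dots,a_n)\in\mathcal A^n$ for which there exist $b_1,\dots,b_n\in\mathcal A$ with $\sum_{i=1}^n b_ia_i=1$, and $Rg_n(\mathcal A)$ is the set of $(a_1,\dots,a_n)\in\mathcal A^n$ for which there exist $b_1,\dots,b_n\in\mathcal A$ with $\sum_{i=1}^n a_ib_i=1$. The left topological stable rank $\operatorname{ltsr}(\mathcal A)$ (resp. right topological stable rank $\operatorname{rtsr}(\mathcal A)$) is the least positive integer $n$ for which $Lg_n(\mathcal A)$ (resp. $Rg_n(\mathcal A)$) is norm dense in $\mathcal A^n$, and is $\infty$ if no such $n$ exists. A nest $\mathcal N$ on a Hilbert space $\mathfrak H$ is a chain of closed subspaces of $\mathfrak H$ containing $\{0\}$ and $\mathfrak H$ and closed under arbitrary intersections and closed linear spans; it is ordered by inclusion. For $N\in\mathcal N$, $N_+=\inf\{M\in\mathcal N: M>N\}$; if $N_+\ne N$, then $N_+\ominus N$ is called an atom of $\mathcal N$. The nest algebra is $\mathcal T(\mathcal N)=\{T\in\mathcal B(\mathfrak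 H): TN\subseteq N\text{ for all }N\in\mathcal N\}$, with the operator norm. If $(\beta,\le)$ is an ordinal, its dual is the totally ordered set $(\beta^*,\le_* )$ where $\beta^*=\beta$ and $x\le_* y$ if and only if $y\le x$. *)

(* Defs.v *)
From HB Require Import structures.
From mathcomp Require Import all_boot all_order all_algebra.
From mathcomp Require Import complex.
From mathcomp Require Import wochoice all_classical all_reals all_analysis.

Set Implicit Arguments.
Unset Strict Implicit.
Unset Printing Implicit Defensive.

Import Order.TTheory GRing.Theory Num.Theory numFieldNormedType.Exports.

Local Open Scope classical_set_scope.
Local Open Scope complex_scope.
Local Open Scope ring_scope.

(* [inner] is linear in its first argument and conjugate-linear in the second. *)
HB.mixin Record isHilbert (R : realType) H & CompleteNormedModule R[i] H := {
  inner : {dot H for Num.conj} ;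
  sqr_norm_inner : forall x : H, `|x| ^+ 2 = inner x x
}.

#[short(type="hilbertType")]
HB.structure Definition Hilbert (R : realType) :=
  {H of CompleteNormedModule R[i] H & isHilbert R H}.

(* The product is given by dedicated operations [bmul] and [bone] because a
   structure inheriting from both rings and normed modules would have to be
   declared before [Num.NumDomain]. The zero algebra is allowed, so that every
   nest algebra is an instance; for this reason [`|bone| = 1] is not required. *)
HB.mixin Record isBanachAlgebra (K : numFieldType) A
    & CompleteNormedModule K A := {
  bmul : A -> A -> A ;
  bone : A ;
  bmulA : associative bmul ;
  bmul1l : left_id bone bmul ;
  bmul1r : right_id bone bmul ;
  bmulDl : left_distributive bmul +%R ;
  bmulDr : right_distributive bmul +%R ;
  bmulZl : forall (k : K) (x y : A), bmul (k *: x) y = k *: bmul x y ;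
  bmulZr : forall (k : K) (x y : A), bmul x (k *: y) = k *: bmul x y ;
  bmul_norm : forall x y : A, `|bmul x y| <= `|x| * `|y|
}.

#[short(type="banachAlgType")]
HB.structure Definition BanachAlgebra (K : numFieldType) :=
  {A of CompleteNormedModule K A & isBanachAlgebra K A}.

Arguments bone {K A} : rename.

(* In this definition and the next, [A ^ n] is ['rV[A]_n], whose topology is
   that of the maximum norm. *)
Definition Lg (K : numFieldType) (A : banachAlgType K) n : set 'rV[A]_n :=
  [set a | exists b : 'rV[A]_n, \sum_(i < n) bmul (b 0 i) (a 0 i) = bone].

Definition Rg (K : numFieldType) (A : banachAlgType K) n : set 'rV[A]_n :=
  [set a | exists b : 'rV[A]_n, \sum_(i < n) bmul (a 0 i) (b 0 i) = bone].

Definition least_pos (P : nat -> Prop) : \bar nat :=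
  if pselect (exists n, (0 < n)%N && `[< P n >]) is left ex
  then (ex_minn ex)%:E else +oo%E.

Definition ltsr (K : numFieldType) (A : banachAlgType K) : \bar nat :=
  least_pos (fun n => dense (@Lg K A n)).

Definition rtsr (K : numFieldType) (A : banachAlgType K) : \bar nat :=
  least_pos (fun n => dense (@Rg K A n)).

Section BoundedOperators.
Context {R : realType} {H : hilbertType R}.

(* B(H), the bounded linear operators on H. *)
Record bop := Bop {
  bop_fun :> H -> H ;
  bop_linear : linear bop_fun ;
  bop_bounded : exists c : R, forall x, `|bop_fun x| <= c%:C * `|x|
}.

HB.instance Definition _ := gen_eqMixin bop.
HB.instance Definition _ := gen_choiceMixin bop.
HB.instance Definition _ (T : bop) :=
  GRing.isLinear.Build R[i] H H _ (bop_fun T) (bop_linear T).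

Lemma bop_eqP (S T : bop) : S =1 T -> S = T.
Proof.
case: S T => [S lS bS] [T lT bT] /= /funext ST.
by subst T; congr Bop; exact: Prop_irrelevance.
Qed.

Let bound0 (T : bop) : exists2 c : R[i], 0 <= c & forall x, `|T x| <= c * `|x|.
Proof.
have [c Tc] := bop_bounded T; exists (Num.max c 0)%:C.
  by rewrite lecR le_max lexx orbT.
by move=> x; rewrite (le_trans (Tc x))// ler_wpM2r// lecR le_max lexx.
Qed.

Let mkbound (f : H -> H) (c : R[i]) : 0 <= c ->
  (forall x, `|f x| <= c * `|x|) ->
  exists d : R, forall x, `|f x| <= d%:C * `|x|.
Proof.
move=> c0 fc; exists (complex.Re c).
by rewrite RRe_real// ger0_real.
Qed.

Lemma bop0_subproof : exists c : R, forall x : H, `|\0 x : H| <= c%:C * `|x|.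
Proof. by exists 0 => x; rewrite normr0 mul0r. Qed.

Lemma bopD_subproof (S T : bop) :
  exists c : R, forall x : H, `|(S \+ T) x| <= c%:C * `|x|.
Proof.
have [c c0 Sc] := bound0 S; have [d d0 Td] := bound0 T.
apply: (@mkbound _ (c + d)); first by rewrite addr_ge0.
by move=> x; rewrite mulrDl (le_trans (ler_normD _ _))// lerD.
Qed.

Lemma bopZ_subproof (k : R[i]) (T : bop) :
  exists c : R, forall x : H, `|(k \*: T) x| <= c%:C * `|x|.
Proof.
have [c c0 Tc] := bound0 T.
apply: (@mkbound _ (`|k| * c)); first by rewrite mulr_ge0.
by move=> x; rewrite normrZ -mulrA ler_wpM2l.
Qed.

Lemma bopM_subproof (S T : bop) :
  exists c : R, forall x : H, `|(S \o T) x| <= c%:C * `|x|.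
Proof.
have [c c0 Sc] := bound0 S; have [d d0 Td] := bound0 T.
apply: (@mkbound _ (c * d)); first by rewrite mulr_ge0.
by move=> x /=; rewrite (le_trans (Sc _))// -mulrA ler_wpM2l.
Qed.

Lemma bop1_subproof : exists c : R, forall x : H, `|idfun x| <= c%:C * `|x|.
Proof. by exists 1 => x; rewrite mul1r. Qed.

Definition bop0 := Bop (@linearP _ _ _ _ (\0 : {linear H -> H})) bop0_subproof.
Definition bopD (S T : bop) :=
  Bop (@linearP _ _ _ _ ((S \+ T) : {linear H -> H})) (bopD_subproof S T).
Definition bopZ (k : R[i]) (T : bop) :=
  Bop (@linearP _ _ _ _ ((k \*: T) : {linear H -> H})) (bopZ_subproof k T).
Definition bopM (S T : bop) :=
  Bop (@linearP _ _ _ _ ((S \o T) : {linear H -> H})) (bopM_subproof S T).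
Definition bop1 :=
  Bop (@linearP _ _ _ _ (idfun : {linear H -> H})) bop1_subproof.

Let bopDA : associative bopD.
Proof. by move=> S T U; apply: bop_eqP => x; exact: addrA. Qed.
Let bopDC : commutative bopD.
Proof. by move=> S T; apply: bop_eqP => x; exact: addrC. Qed.
Let bop0D : left_id bop0 bopD.
Proof. by move=> S; apply: bop_eqP => x; exact: add0r. Qed.
Let bopND : left_inverse bop0 (bopZ (-1)) bopD.
Proof. by move=> S; apply: bop_eqP => x /=; rewrite scaleN1r addNr. Qed.

HB.instance Definition _ := GRing.isZmodule.Build bop bopDA bopDC bop0D bopND.

Let bopZA k l (T : bop) : bopZ k (bopZ l T) = bopZ (k * l) T.
Proof. by apply: bop_eqP => x; exact: scalerA. Qed.
Let bop1Z : left_id 1 bopZ.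
Proof. by move=> S; apply: bop_eqP => x; exact: scale1r. Qed.
Let bopZDr : right_distributive bopZ +%R.
Proof. by move=> k S T; apply: bop_eqP => x; exact: scalerDr. Qed.
Let bopZDl T : {morph bopZ^~ T : k l / k + l}.
Proof. by move=> k l; apply: bop_eqP => x; exact: scalerDl. Qed.

HB.instance Definition _ :=
  GRing.Zmodule_isLmodule.Build R[i] bop bopZA bop1Z bopZDr bopZDl.

(* The supremum is taken in R and embedded in R[i], where norms take their
   values; [`|T x|] is a nonnegative element of R[i]. *)
Definition opnorm (T : bop) : R[i] :=
  (sup [set complex.Re `|T x| | x in [set x : H | `|x| <= 1]])%:C.

Let ReK (x : H) : (complex.Re `|x|)%:C = `|x|.
Proof. by rewrite RRe_real// ger0_real. Qed.

Let opnorm_ub (T : bop) :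
  has_ubound [set complex.Re `|T x| | x in [set x : H | `|x| <= 1]].
Proof.
have [c c0 Tc] := bound0 T; exists (complex.Re c) => _ [y /= y1 <-].
rewrite -lecR ReK RRe_real ?ger0_real// (le_trans (Tc y))//.
by rewrite ler_piMr.
Qed.

Lemma opnorm_ge0 T : 0 <= opnorm T.
Proof.
rewrite -[0]/(0%:C) lecR (@le_trans _ _ (complex.Re `|T 0|))//; last first.
  by apply: ub_le_sup => //; exists 0 => //=; rewrite normr0.
by rewrite -lecR ReK; exact: normr_ge0.
Qed.

Lemma le_opnormM (T : bop) x : `|T x| <= opnorm T * `|x|.
Proof.
have [->|x0] := eqVneq x 0; first by rewrite linear0 !normr0 mulr0.
have nx : 0 < `|x| by rewrite normr_gt0.
rewrite -ler_pdivrMr//.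
have -> : `|T x| / `|x| = `|T (`|x|^-1 *: x)|.
  by rewrite linearZ normrZ normfV normr_id mulrC.
rewrite -ReK lecR; apply: ub_le_sup => //.
by exists (`|x|^-1 *: x) => //=; rewrite normrZ normfV normr_id mulVf// gt_eqF.
Qed.

Lemma opnorm_le (T : bop) c : 0 <= c -> (forall x, `|T x| <= c * `|x|) ->
  opnorm T <= c.
Proof.
move=> c0 Tc; rewrite -[c]RRe_real ?ger0_real// lecR; apply: ge_sup.
  by exists (complex.Re `|T 0|), 0 => //=; rewrite normr0.
move=> _ [x /= x1 <-]; rewrite -lecR ReK RRe_real ?ger0_real//.
by rewrite (le_trans (Tc x))// ler_piMr.
Qed.

Let opnormD (S T : bop) : opnorm (S + T) <= opnorm S + opnorm T.
Proof.
apply: opnorm_le => [|x]; first by rewrite addr_ge0 ?opnorm_ge0.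
by rewrite mulrDl (le_trans (ler_normD _ _))// lerD// le_opnormM.
Qed.

Let opnormZ (k : R[i]) (T : bop) : opnorm (k *: T) = `|k| * opnorm T.
Proof.
have le l S : opnorm (l *: S) <= `|l| * opnorm S.
  apply: opnorm_le => [|x]; first by rewrite mulr_ge0 ?opnorm_ge0.
  by rewrite -mulrA [`|_|]normrZ ler_wpM2l// le_opnormM.
apply/eqP; rewrite eq_le le /=.
have [->|k0] := eqVneq k 0; first by rewrite normr0 mul0r opnorm_ge0.
rewrite -ler_pdivlMl ?normr_gt0// -normfV.
by rewrite -[leLHS](_ : opnorm (k^-1 *: (k *: T)) = _) ?le// scalerA mulVf//
  scale1r.
Qed.

Let opnorm_eq0 (T : bop) : opnorm T = 0 -> T = 0.
Proof.
move=> T0; apply: bop_eqP => x; apply/eqP; rewrite -normr_le0.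
by rewrite (le_trans (le_opnormM T x))// T0 mul0r.
Qed.

HB.instance Definition _ :=
  Lmodule_isNormed.Build R[i] bop opnormD opnormZ opnorm_eq0.

Lemma bop_normE (T : bop) : `|T| = opnorm T. Proof. by []. Qed.

Lemma le_bop_normM (T : bop) x : `|T x| <= `|T| * `|x|.
Proof. exact: le_opnormM. Qed.

Let bopMnorm (S T : bop) : `|bopM S T| <= `|S| * `|T|.
Proof.
apply: opnorm_le => [|x]; first by rewrite mulr_ge0.
by rewrite (le_trans (le_bop_normM S (T x)))// -mulrA ler_wpM2l//
  le_bop_normM.
Qed.

Let bopMA : associative bopM.
Proof. by move=> S T U; apply: bop_eqP. Qed.
Let bop1M : left_id bop1 bopM.
Proof. by move=> S; apply: bop_eqP. Qed.
Let bopM1 : right_id bop1 bopM.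
Proof. by move=> S; apply: bop_eqP. Qed.
Let bopMDl : left_distributive bopM +%R.
Proof. by move=> S T U; apply: bop_eqP. Qed.
Let bopMDr : right_distributive bopM +%R.
Proof. by move=> S T U; apply: bop_eqP => x /=; rewrite linearD. Qed.
Let bopMZl k S T : bopM (k *: S) T = k *: bopM S T.
Proof. exact: bop_eqP. Qed.
Let bopMZr k S T : bopM S (k *: T) = k *: bopM S T.
Proof. by apply: bop_eqP => x /=; rewrite linearZ. Qed.

Let bop_complete (F : set_system bop) : ProperFilter F -> cauchy F -> cvg F.
Proof.
move=> FF /cauchyP Fc.
have evalE (S T : bop) x : `|S x - T x| <= `|S - T| * `|x|.
  by rewrite -scaleN1r; exact: (le_bop_normM (S - T) x).
have Fx x : cvg ((fun S : bop => S x) @ F).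
  apply: cauchy_cvg; apply: cauchy_exP => e e0.
  have d0 : 0 < e / (`|x| + 1) by rewrite divr_gt0// ltr_pwDr.
  have [T FT] := Fc _ d0; exists (T x).
  suff : F [set S : bop | ball (T x) e (S x)] by [].
  apply: filterS FT => S.
  rewrite /= -!ball_normE /= => TS; rewrite (le_lt_trans (evalE _ _ _))//.
  rewrite (@le_lt_trans _ _ (`|T - S| * (`|x| + 1)))//.
    by rewrite ler_wpM2l// lerDl.
  by rewrite -ltr_pdivlMr// ltr_pwDr.
pose L x := lim ((fun S : bop => S x) @ F).
have Llin : linear L.
  move=> k x y; rewrite /L; apply: (cvg_lim (@norm_hausdorff _ _)).
  rewrite (_ : (fun S : bop => S (k *: x + y)) =
               (fun S : bop => k *: S x + S y)).
    by apply: cvgD; [apply: cvgZl_tmp|]; exact: Fx.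
  by apply/funext => S; rewrite linearP.
have near_L (T : bop) e x : (\forall S \near F, `|T - S| <= e) ->
    `|T x - L x| <= e * `|x|.
  move=> TS; apply/ler_addgt0Pr => d d0.
  have LS0 : F [set S : bop | `|L x - S x| <= d].
    exact: (@cvgr_dist_le _ _ _ F _ (fun S : bop => S x) (L x) (Fx x) d d0).
  have [S [TSe LS]] := filter_ex (filterI TS LS0).
  rewrite (_ : T x - L x = (T x - S x) + (S x - L x)); last first.
    by rewrite addrA subrK.
  rewrite (le_trans (ler_normD _ _))// lerD//.
    by rewrite (le_trans (evalE _ _ _))// ler_wpM2r.
  by rewrite distrC.
have Lb : exists c : R, forall x, `|L x| <= c%:C * `|x|.
  have [T FT] := Fc 1 ltr01; apply: (@mkbound _ (`|T| + 1)) => [|x].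
    by rewrite addr_ge0.
  rewrite mulrDl -[L x](subKr (T x)) (le_trans (ler_normB _ _))// lerD//.
    exact: le_bop_normM.
  by apply: near_L; apply: filterS FT => S; rewrite -ball_normE /= => /ltW.
apply/cvg_ex; exists (Bop Llin Lb).
apply/(@cvgrPdist_le _ _ _ F _ idfun) => e e0.
have e20 : 0 < e / 2 by rewrite divr_gt0.
have [T FT] := Fc _ e20; apply: filterS (FT) => S.
rewrite -ball_normE /= => TS.
rewrite [e]splitr -(subrKA T) (le_trans (ler_normD _ _))// lerD//; last exact: ltW.
rewrite distrC; apply: opnorm_le => [|x]; first by rewrite divr_ge0// ltW.
suff : `|T x - L x| <= e / 2 * `|x| by rewrite -scaleN1r.
by apply: near_L; apply: filterS FT => U; rewrite -ball_normE /= => /ltW.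
Qed.

HB.instance Definition _ := Uniform_isComplete.Build bop bop_complete.
HB.instance Definition _ := isBanachAlgebra.Build R[i] bop
  bopMA bop1M bopM1 bopMDl bopMDr bopMZl bopMZr bopMnorm.

End BoundedOperators.
Arguments bop {R} H.

Definition linear_subspace (R : realType) (H : hilbertType R) (M : set H) :=
  M 0 /\ forall (k : R[i]) x y, M x -> M y -> M (k *: x + y).

Definition linspan (R : realType) (H : hilbertType R) (A : set H) : set H :=
  [set x | exists n (k : 'I_n -> R[i]) (v : 'I_n -> H),
    (forall i, A (v i)) /\ x = \sum_(i < n) k i *: v i].

Definition finite_dim (R : realType) (H : hilbertType R) (M : set H) :=
  exists2 B : set H, finite_set B & M = linspan B.

Definition separable (T : topologicalType) :=
  exists2 D : set T, countable D & dense D.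

(* The empty family is allowed in the last two fields; it yields [set: H] and
   [set 0], which belong to every nest anyway. *)
Structure nest (R : realType) (H : hilbertType R) := Nest {
  nest_set : set (set H) ;
  nest_subspace : forall M, nest_set M -> linear_subspace M ;
  nest_closed : forall M, nest_set M -> closed M ;
  nest_chain : forall M N, nest_set M -> nest_set N -> M `<=` N \/ N `<=` M ;
  nest0 : nest_set [set 0] ;
  nestT : nest_set [set: H] ;
  nest_bigcap : forall F : set (set H), F `<=` nest_set ->
    nest_set (\bigcap_(M in F) M) ;
  nest_bigspan : forall F : set (set H), F `<=` nest_set ->
    nest_set (closure (linspan (\bigcup_(M in F) M)))
}.

(* For [M = setT] the family is empty and the intersection is [setT], so that
   [setT] is its own successor. *)
Definition nest_succ (R : realType) (H : hilbertType R) (N : nest H)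
    (M : set H) : set H :=
  \bigcap_(L in [set L | nest_set N L /\ M `<` L]) L.

Definition ominus (R : realType) (H : hilbertType R) (L M : set H) : set H :=
  [set x | L x /\ forall y, M y -> inner x y = 0].

Definition atom (R : realType) (H : hilbertType R) (N : nest H) (E : set H) :=
  exists M, [/\ nest_set N M, nest_succ N M <> M & E = ominus (nest_succ N M) M].

Section NestAlgebra.
Context {R : realType} {H : hilbertType R} (N : nest H).

(* T(N), with the operations and the norm of B(H). *)
Record nest_alg := NestAlg {
  nest_bop :> bop H ;
  nest_invariant : forall M, nest_set N M -> nest_bop @` M `<=` M
}.

HB.instance Definition _ := gen_eqMixin nest_alg.
HB.instance Definition _ := gen_choiceMixin nest_alg.

Lemma nest_alg_inj (S T : nest_alg) : nest_bop S = nest_bop T -> S = T.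
Proof.
case: S T => [S iS] [T iT] /= ST; subst T.
by congr NestAlg; exact: Prop_irrelevance.
Qed.

Let inv0 M : nest_set N M -> (0 : bop H) @` M `<=` M.
Proof. by move=> /nest_subspace[M0 _] _ [x _ <-]. Qed.
Let invD (S T : nest_alg) M : nest_set N M ->
  ((S : bop H) + (T : bop H)) @` M `<=` M.
Proof.
move=> NM _ [x Mx <-] /=; have [_ Mlin] := nest_subspace NM.
rewrite -[S x]scale1r; apply: Mlin.
  by apply: (nest_invariant NM); exists x.
by apply: (nest_invariant NM); exists x.
Qed.
Let invZ k (T : nest_alg) M : nest_set N M -> (k *: (T : bop H)) @` M `<=` M.
Proof.
move=> NM _ [x Mx <-] /=; have [M0 Mlin] := nest_subspace NM.
rewrite -[_ *: _]addr0; apply: Mlin => //.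
by apply: (nest_invariant NM); exists x.
Qed.
Let invM (S T : nest_alg) M : nest_set N M -> (bmul (S : bop H) T) @` M `<=` M.
Proof.
move=> NM _ [x Mx <-] /=; apply: (nest_invariant NM); exists (T x) => //.
by apply: (nest_invariant NM); exists x.
Qed.
Let inv1 M : nest_set N M -> (bone : bop H) @` M `<=` M.
Proof. by move=> NM _ [x Mx <-]. Qed.

Definition nest_alg0 := NestAlg inv0.
Definition nest_algD S T := NestAlg (@invD S T).
Definition nest_algZ k T := NestAlg (@invZ k T).
Definition nest_algM S T := NestAlg (@invM S T).
Definition nest_alg1 := NestAlg inv1.

Let DA : associative nest_algD.
Proof. by move=> S T U; apply: nest_alg_inj; exact: addrA. Qed.
Let DC : commutative nest_algD.
Proof. by move=> S T; apply: nest_alg_inj; exact: addrC. Qed.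
Let add0 : left_id nest_alg0 nest_algD.
Proof. by move=> S; apply: nest_alg_inj; exact: add0r. Qed.
Let addN : left_inverse nest_alg0 (nest_algZ (-1)) nest_algD.
Proof. by move=> S; apply: nest_alg_inj; rewrite /= scaleN1r addNr. Qed.

HB.instance Definition _ := GRing.isZmodule.Build nest_alg DA DC add0 addN.

Let ZA k l T : nest_algZ k (nest_algZ l T) = nest_algZ (k * l) T.
Proof. by apply: nest_alg_inj; exact: scalerA. Qed.
Let Z1 : left_id 1 nest_algZ.
Proof. by move=> S; apply: nest_alg_inj; exact: scale1r. Qed.
Let ZDr : right_distributive nest_algZ +%R.
Proof. by move=> k S T; apply: nest_alg_inj; exact: scalerDr. Qed.
Let ZDl T : {morph nest_algZ^~ T : k l / k + l}.
Proof. by move=> k l; apply: nest_alg_inj; exact: scalerDl. Qed.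

HB.instance Definition _ :=
  GRing.Zmodule_isLmodule.Build R[i] nest_alg ZA Z1 ZDr ZDl.

Definition nest_alg_norm (T : nest_alg) : R[i] := `|nest_bop T|.
Let normD S T : nest_alg_norm (S + T) <= nest_alg_norm S + nest_alg_norm T.
Proof. exact: ler_normD. Qed.
Let normZ k T : nest_alg_norm (k *: T) = `|k| * nest_alg_norm T.
Proof. exact: normrZ. Qed.
Let norm_eq0 T : nest_alg_norm T = 0 -> T = 0.
Proof. by move=> /normr0_eq0 T0; exact: nest_alg_inj. Qed.

HB.instance Definition _ :=
  Lmodule_isNormed.Build R[i] nest_alg normD normZ norm_eq0.

Let complete (F : set_system nest_alg) : ProperFilter F -> cauchy F -> cvg F.
Proof.
move=> FF /cauchyP Fc.
have subE (S T : nest_alg) : `|S - T| = `|nest_bop S - nest_bop T|.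
  by rewrite -[in RHS]scaleN1r -[in LHS]scaleN1r.
have : cvg (nest_bop @ F).
  apply: cauchy_cvg; apply: cauchy_exP => e e0.
  have [T FT] := Fc _ e0; exists (nest_bop T).
  suff : F [set S | ball (nest_bop T) e (nest_bop S)] by [].
  by apply: filterS FT => S; rewrite -!ball_normE /= subE.
move=> /cvg_ex[L FL].
have Linv M : nest_set N M -> L @` M `<=` M.
  move=> NM _ [x Mx <-].
  have FLx : (fun S : nest_alg => S x) @ F --> L x.
    apply/(@cvgrPdist_le _ _ _ F _ (fun S : nest_alg => S x)) => e e0.
    have d0 : 0 < e / (`|x| + 1) by rewrite divr_gt0// ltr_pwDr.
    have Fd : F [set S | `|L - nest_bop S| <= e / (`|x| + 1)].
      exact: (@cvgr_dist_le _ _ _ F _ nest_bop L FL _ d0).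
    suff : F [set S : nest_alg | `|L x - S x| <= e] by [].
    apply: filterS Fd => S /= LS.
    have := le_bop_normM (L - S) x; rewrite /= scaleN1r => /le_trans; apply.
    rewrite (@le_trans _ _ (`|L - S| * (`|x| + 1)))//.
      by rewrite ler_wpM2l// lerDl.
    by rewrite -ler_pdivlMr// ltr_pwDr.
  apply: (@closed_cvg _ _ F _ (fun S : nest_alg => S x) M (nest_closed NM)
    _ _ FLx).
  by apply: nearW => S; apply: (nest_invariant NM); exists x.
apply/cvg_ex; exists (NestAlg Linv).
apply/(@cvgrPdist_le _ _ _ F _ idfun) => e e0.
have Fd : F [set S | `|L - nest_bop S| <= e].
  exact: (@cvgr_dist_le _ _ _ F _ nest_bop L FL _ e0).
suff : F [set S : nest_alg | `|NestAlg Linv - S| <= e] by [].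
by apply: filterS Fd => S /=; rewrite subE.
Qed.

HB.instance Definition _ := Uniform_isComplete.Build nest_alg complete.

Let MA : associative nest_algM.
Proof. by move=> S T U; apply: nest_alg_inj; exact: bmulA. Qed.
Let M1l : left_id nest_alg1 nest_algM.
Proof. by move=> S; apply: nest_alg_inj; exact: bmul1l. Qed.
Let M1r : right_id nest_alg1 nest_algM.
Proof. by move=> S; apply: nest_alg_inj; exact: bmul1r. Qed.
Let MDl : left_distributive nest_algM +%R.
Proof. by move=> S T U; apply: nest_alg_inj; exact: bmulDl. Qed.
Let MDr : right_distributive nest_algM +%R.
Proof. by move=> S T U; apply: nest_alg_inj; exact: bmulDr. Qed.
Let MZl k S T : nest_algM (k *: S) T = k *: nest_algM S T.
Proof. by apply: nest_alg_inj; exact: bmulZl. Qed.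
Let MZr k S T : nest_algM S (k *: T) = k *: nest_algM S T.
Proof. by apply: nest_alg_inj; exact: bmulZr. Qed.
Let Mnorm S T : `|nest_algM S T| <= `|S| * `|T|.
Proof. exact: bmul_norm. Qed.

HB.instance Definition _ := isBanachAlgebra.Build R[i] nest_alg
  MA M1l M1r MDl MDr MZl MZr Mnorm.

End NestAlgebra.

Definition order_iso (R : realType) (H : hilbertType R) (N : nest H)
    (d : Order.disp_t) (T : orderType d) :=
  exists2 f : set H -> T, set_bij (nest_set N) setT f &
    forall L M, nest_set N L -> nest_set N M -> (L `<=` M <-> (f L <= f M)%O).

(* An ordinal is a well-ordered type [B] (every nonempty subset has a unique
   least element); its dual is [B^d], on which [x <=^d y] is [y <= x]. *)
Definition iso_ordinal (R : realType) (H : hilbertType R) (N : nest H) :=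
  exists (d : Order.disp_t) (B : orderType d),
    well_order (<=%O : rel B) /\ order_iso N B.

Definition iso_dual_ordinal (R : realType) (H : hilbertType R) (N : nest H) :=
  exists (d : Order.disp_t) (B : orderType d),
    well_order (<=%O : rel B) /\ order_iso N (B^d)%type.

(* Main.v *)
Require Import Defs.
From HB Require Import structures.
From mathcomp Require Import all_boot all_order all_algebra.
From mathcomp Require Import complex.
From mathcomp Require Import all_classical all_reals all_analysis.
From mathcomp Require wochoice.
Import Order.TTheory GRing.Theory Num.Theory numFieldNormedType.Exports.
Set Implicit Arguments.
Unset Strict Implicit.
Unset Printing Implicit Defensive.
Local Open Scope classical_set_scope.
Local Open Scope complex_scope.
Local Open Scope ring_scope.

(** Both ranks are infinite as soon as, for every [n > 0], some row of length
    [n] is not a limit of left invertible rows, and some row is not a limit of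
    right invertible ones. The obstruction is an index argument: a column of
    operators that is onto and has a nonzero kernel cannot be approximated by
    left invertible ones, and a row that is isometric but not onto cannot be
    approximated by right invertible ones. It suffices to have this on an
    interval [ominus L M] of the nest, because compression to an interval is
    multiplicative on the nest algebra ([not_dense_Lg], [not_dense_Rg]). In each
    case only one of the two mutually inverse families of operators has to
    belong to the algebra.

    Such families are built by moving the vectors of an orthonormal basis. If
    the nest has an infinite dimensional atom, the algebra contains all rank-one
    operators on it, and both families are available ([tsr_infinite_atom]). If
    the nest contains a strictly increasing sequence, a basis of its span
    adapted to the successive gaps can be shifted downwards inside the algebra,
    which gives infinite left rank ([ltsr_increasing]). A strictly decreasing
    sequence allows upward shifts and gives infinite right rank
    ([rtsr_decreasing]).

    It remains to see that an uncountable nest, or a countable one that is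
    neither an ordinal nor the dual of one, contains sequences of both kinds.
    Without a strictly decreasing sequence the nest is well-ordered by
    inclusion, so it is an ordinal; it is also countable, since unit vectors
    chosen in the gaps above its members form an orthonormal family in a
    separable space ([well_ordered_nest_ordinal],
    [well_ordered_nest_countable]).
    The argument for increasing sequences is dual. *)

(** * Inner products and closed subspaces *)

Section HilbertBasics.
Context {R : realType} {H : hilbertType R}.
Implicit Types (x y z : H) (k : R[i]).

Local Notation "''[' x , y ]" := (inner x y).

Lemma innerC x y : '[x, y] = ('[y, x])^*%R.
Proof. by rewrite hermC expr0 mul1r. Qed.

Lemma inner0l y : '[0, y] = 0. Proof. exact: linear0l. Qed.
Lemma inner0r x : '[x, 0] = 0. Proof. exact: linear0r. Qed.
Lemma innerDl x y z : '[x + y, z] = '[x, z] + '[y, z].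
Proof. exact: linearDl. Qed.
Lemma innerBl x y z : '[x - y, z] = '[x, z] - '[y, z].
Proof. exact: linearBl. Qed.
Lemma innerZl k x y : '[k *: x, y] = k * '[x, y].
Proof. exact: linearZl_LR. Qed.
Lemma innerZr k x y : '[x, k *: y] = k^*%R * '[x, y].
Proof. exact: linearZr_LR. Qed.
Lemma innerNr x y : '[x, - y] = - '[x, y]. Proof. exact: linearNr. Qed.
Lemma inner_suml I (r : seq I) (P : pred I) (F : I -> H) y :
  '[\sum_(i <- r | P i) F i, y] = \sum_(i <- r | P i) '[F i, y].
Proof. exact: linear_sumlz. Qed.
Lemma inner_eq0C x y : '[x, y] = 0 -> '[y, x] = 0.
Proof. by rewrite innerC => /eqP; rewrite conjC_eq0 => /eqP. Qed.
Lemma innerxx_eq0 x : '[x, x] = 0 -> x = 0.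
Proof. by move=> /eqP; rewrite dnorm_eq0 => /eqP. Qed.

Lemma pythagoras x y : '[x, y] = 0 -> `|x + y| ^+ 2 = `|x| ^+ 2 + `|y| ^+ 2.
Proof. by move=> xy; rewrite !sqr_norm_inner hnormDd. Qed.

Lemma cauchy_schwarz x y : `|'[x, y]| <= `|x| * `|y|.
Proof.
have [->|y0] := eqVneq y 0; first by rewrite inner0r !normr0 mulr0.
have ny : 0 < `|y| by rewrite normr_gt0.
(* [a *: y] is the orthogonal projection of [x] on the line of [y]. *)
pose a := '[x, y] / `|y| ^+ 2; pose z := x - a *: y.
have zy : '[z, a *: y] = 0.
  rewrite innerZr innerBl innerZl -sqr_norm_inner divfK ?subrr ?mulr0//.
  by rewrite expf_neq0// gt_eqF.
have := pythagoras zy; rewrite subrK => xE.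
rewrite -(@ler_pXn2r _ 2)// ?nnegrE ?mulr_ge0// exprMn xE mulrDl.
rewrite ler_wpDl ?mulr_ge0 ?exprn_ge0// -exprMn normrZ normrM normfV normrX.
rewrite normr_id expr2; have : `|y| != 0 by rewrite gt_eqF.
by move: `|y| => t t0; rewrite invfM mulrA !divfK.
Qed.

Lemma inner_cvg (u : nat -> H) (l y : H) : u @ \oo --> l ->
  (fun n => '[u n, y]) @ \oo --> '[l, y].
Proof.
move=> ul; apply/cvgrPdist_le => e e0.
have d0 : 0 < e / (`|y| + 1) by rewrite divr_gt0// ltr_pwDr.
have : \forall n \near \oo, `|l - u n| <= e / (`|y| + 1).
  exact: (@cvgr_dist_le _ _ _ _ _ u l ul _ d0).
apply: filterS => n; rewrite -innerBl => lu.
rewrite (le_trans (cauchy_schwarz _ _))//.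
rewrite (@le_trans _ _ (`|l - u n| * (`|y| + 1)))//.
  by rewrite ler_wpM2l// lerDl.
by rewrite -ler_pdivlMr// ltr_pwDr.
Qed.

(** Convergence is read off from a bounded real sequence whose increments
    dominate those of [u]. The exponent lets one criterion serve orthogonal
    series, where squared norms telescope ([e = 2]), and geometric series
    ([e = 1]). *)
Lemma cvg_dominated (u : nat -> H) (s : nat -> R) (b : R) (e : nat) :
  (0 < e)%N -> (forall n, s n <= b) ->
  (forall p q, (p <= q)%N -> `|u q - u p| ^+ e <= (s q - s p)%:C) ->
  cvg (u @ \oo).
Proof.
move=> e0 sb us; apply: cauchy_cvg; apply: cauchy_exP => d d0.
have dE : (complex.Re (d ^+ e))%:C = d ^+ e.
  by rewrite RRe_real// ger0_real// exprn_ge0// ltW.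
have de0 : 0 < complex.Re (d ^+ e) by rewrite -ltcR dE exprn_gt0.
have hs : has_sup (range s).
  by split; [exists (s 0%N), 0%N | exists b => _ [n _ <-]].
have [_ [N _ <-] sN] := sup_adherent de0 hs.
exists (u N); exists N => // n /= Nn; rewrite -ball_normE /=.
rewrite distrC -(@ltr_pXn2r _ e)// ?nnegrE ?(ltW d0)//.
rewrite (le_lt_trans (us _ _ Nn))//.
rewrite -dE ltcR (le_lt_trans _ (_ : sup (range s) - s N < _))//; last first.
  by rewrite ltrBlDr -ltrBlDl.
rewrite lerB//.
by apply: ub_le_sup; [case: hs | exists n].
Qed.

Definition closed_subspace (M : set H) := linear_subspace M /\ closed M.

Section subspace.
Context (M : set H) (MS : closed_subspace M).
Lemma subspace0 : M 0. Proof. by case: MS => -[]. Qed.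
Lemma subspaceD x y : M x -> M y -> M (x + y).
Proof. by case: MS => -[_ L] _ Mx My; rewrite -[x]scale1r; exact: L. Qed.
Lemma subspaceZ k x : M x -> M (k *: x).
Proof.
by case: MS => -[M0 L] _ Mx; rewrite -[_ *: _]addr0; exact: L.
Qed.
Lemma subspaceB x y : M x -> M y -> M (x - y).
Proof. by move=> Mx My; rewrite -scaleN1r; apply/subspaceD/subspaceZ. Qed.
Lemma subspace_sum I (r : seq I) (P : pred I) (F : I -> H) :
  (forall i, P i -> M (F i)) -> M (\sum_(i <- r | P i) F i).
Proof.
by move=> MF; apply: big_ind => //; [exact: subspace0 | exact: subspaceD].
Qed.
Lemma subspace_lim (u : nat -> H) : cvg (u @ \oo) -> (forall n, M (u n)) ->
  M (lim (u @ \oo)).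
Proof.
move=> uc Mu; apply: (@closed_cvg _ _ _ _ u M MS.2 _ _ uc).
exact: nearW.
Qed.
End subspace.

Lemma closure_approx (A : set H) x (e : R[i]) : closure A x -> 0 < e ->
  exists2 y, A y & `|x - y| < e.
Proof.
move=> Ax e0; have [y [Ay]] := Ax _ (nbhsx_ballx x e e0).
by rewrite -ball_normE; exists y.
Qed.

Lemma ortho_closure (A : set H) x y :
  (forall z, A z -> '[z, y] = 0) -> closure A x -> '[x, y] = 0.
Proof.
move=> Ay Ax; apply/normr0_eq0/eqP; rewrite eq_le normr_ge0 andbT.
apply/ler_addgt0Pr => e e0; rewrite add0r.
have d0 : 0 < e / (`|y| + 1) by rewrite divr_gt0// ltr_pwDr.
have [z Az xz] := closure_approx Ax d0.
rewrite -[x](subrK z) innerDl (Ay z Az) addr0 (le_trans (cauchy_schwarz _ _))//.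
rewrite (@le_trans _ _ (`|x - z| * (`|y| + 1)))//.
  by rewrite ler_wpM2l// lerDl.
by rewrite -ler_pdivlMr ?ltr_pwDr// ltW.
Qed.

Lemma ominus_subspace (L M : set H) : closed_subspace L ->
  closed_subspace (ominus L M).
Proof.
move=> LS; split; first split.
- by split; [exact: subspace0 | move=> y _; rewrite inner0l].
- move=> k x y [Lx Mx] [Ly My]; split.
    by apply: subspaceD => //; exact: subspaceZ.
  by move=> z Mz; rewrite innerDl innerZl Mx// My// mulr0 addr0.
- move=> x cx; split.
    by apply: LS.2; apply: closureS cx => y [].
  by move=> y My; apply: ortho_closure cx => z [_]; exact.
Qed.
End HilbertBasics.

(** * Partial isometries between orthonormal sequences *)

Section Orthoseq.
Context {R : realType} {H : hilbertType R}.
Implicit Types (x y z : H) (k : R[i]) (g h : nat -> H).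

Local Notation "''[' x , y ]" := (inner x y).

(** Entries equal to [0] are allowed, so that every countable orthonormal
    set, finite or not, is the set of nonzero terms of such a sequence. *)
Definition orthoseq g :=
  forall m j, '[g m, g j] = ((m == j) && (g m != 0))%:R.

Lemma inner_orthoseqK g x m : orthoseq g -> '[x, g m] * '[g m, g m] = '[x, g m].
Proof.
move=> og; rewrite og eqxx /=; have [->|_] := eqVneq (g m) 0.
  by rewrite inner0r mul0r.
by rewrite mulr1.
Qed.

Lemma norm_orthoseqZ g k m : orthoseq g -> `|k *: g m| ^+ 2 <= `|k| ^+ 2.
Proof.
move=> og; rewrite sqr_norm_inner dnormZ og eqxx /= ler_piMr ?exprn_ge0//.
by case: (_ != _); rewrite ?ler01.
Qed.

Lemma norm_orthosum g (c : nat -> R[i]) p q : orthoseq g -> (p <= q)%N ->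
  `|\sum_(p <= m < q) c m *: g m| ^+ 2 <= \sum_(p <= m < q) `|c m| ^+ 2.
Proof.
move=> og; elim: q => [|q IH].
  by rewrite leqn0 => /eqP->; rewrite !big_geq// normr0 expr0n.
rewrite leq_eqVlt => /predU1P[->|]; first by rewrite !big_geq// normr0 expr0n.
rewrite ltnS => pq; rewrite !big_nat_recr//= pythagoras.
  by rewrite lerD ?IH//; exact: norm_orthoseqZ.
rewrite inner_suml big_nat big1// => m /andP[_ mq].
by rewrite innerZl innerZr og (ltn_eqF mq) !mulr0.
Qed.

(** The residual [x - \sum_(m < n) '[x, g m] *: g m] accounts exactly for the
    difference of the two sides, by induction on [n] and Pythagoras. *)
Lemma bessel g x n : orthoseq g ->
  \sum_(0 <= m < n) `|'[x, g m]| ^+ 2 <= `|x| ^+ 2.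
Proof.
move=> og.
suff -> : `|x| ^+ 2 = `|x - \sum_(0 <= m < n) '[x, g m] *: g m| ^+ 2 +
                      \sum_(0 <= m < n) `|'[x, g m]| ^+ 2.
  by rewrite lerDr exprn_ge0.
elim: n => [|n IH]; first by rewrite !big_geq// subr0 addr0.
rewrite {}IH !big_nat_recr//=; set s := \sum_(0 <= m < n) '[x, g m] *: g m.
rewrite opprD !addrA.
have sn : '[s, g n] = 0.
  rewrite inner_suml big_nat big1// => m /andP[_ mn].
  by rewrite innerZl og (ltn_eqF mn) mulr0.
rewrite -[in LHS](subrK ('[x, g n] *: g n) (x - s)) pythagoras; last first.
  by rewrite innerZr !innerBl sn subr0 innerZl inner_orthoseqK// subrr mulr0.
rewrite addrAC; congr (_ + _ + _); rewrite sqr_norm_inner dnormZ normCK.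
by rewrite mulrAC inner_orthoseqK.
Qed.

(** The operator is [x |-> \sum_m '[x, g m] *: h m], which converges by
    Bessel's inequality. It maps [g m] to [h m]; with [g = h] it is an
    orthogonal projection. The last clause locates the range and is how
    membership in a nest algebra is checked: each rank-one term of the series
    either lands in [C] or vanishes at [x]. *)
Lemma shift_op_ex g h : orthoseq g -> orthoseq h -> exists U : bop H,
  [/\ forall x, `|U x| <= `|x|,
      forall x m, h m != 0 -> '[U x, h m] = '[x, g m] &
      forall (C : set H) x, closed_subspace C ->
        (forall m, C (h m) \/ '[x, g m] = 0) -> C (U x)].
Proof.
move=> og oh.
pose S x n := \sum_(0 <= m < n) '[x, g m] *: h m.
pose s x n := complex.Re (\sum_(0 <= m < n) `|'[x, g m]| ^+ 2).
have sE x n : (s x n)%:C = \sum_(0 <= m < n) `|'[x, g m]| ^+ 2.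
  by rewrite RRe_real// ger0_real// sumr_ge0// => m _; rewrite exprn_ge0.
have Sc x : cvg (S x @ \oo).
  apply: (@cvg_dominated _ _ _ (s x) (complex.Re (`|x| ^+ 2)) 2) => //
    [n|p q pq].
    by rewrite -lecR sE RRe_real ?ger0_real ?exprn_ge0 ?bessel.
  rewrite rmorphB/= !sE /S !(@big_cat_nat _ _ _ p 0 q)//= ![_ + _ - _]addrAC.
  rewrite !subrr !add0r.
  exact: norm_orthosum.
pose U x : H := lim (S x @ \oo).
have Ulin : linear U.
  move=> k x y; rewrite /U; apply: (cvg_lim (@norm_hausdorff _ _)).
  rewrite (_ : S (k *: x + y) = fun n => k *: S x n + S y n).
    by apply: cvgD; [apply: cvgZl_tmp|]; exact: Sc.
  apply/funext => n; rewrite /S scaler_sumr -big_split/=; apply: eq_bigr => m _.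
  by rewrite innerDl innerZl scalerDl scalerA.
have Ule x : `|U x| <= `|x|.
  apply/ler_addgt0Pr => e e0.
  have /filter_ex[n Sn] : \forall n \near \oo, `|U x - S x n| <= e.
    exact: (@cvgr_dist_le _ _ _ _ _ (S x) (U x) (Sc x) _ e0).
  rewrite -[U x](subrK (S x n)) addrC (le_trans (ler_normD _ _))// lerD//.
  rewrite -(@ler_pXn2r _ 2)// ?nnegrE//.
  by rewrite (le_trans (norm_orthosum _ oh (leq0n n)))// bessel.
have Ub : exists c : R, forall x, `|U x| <= c%:C * `|x|.
  by exists 1 => x; rewrite mul1r.
exists (Bop Ulin Ub); split => //= [x m hm|C x CS Ch].
- have := inner_cvg (y := h m) (Sc x); rewrite -/(U x) => Sh.
  rewrite -(cvg_lim (@norm_hausdorff R[i] R[i]^o) Sh).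
  apply: (cvg_lim (@norm_hausdorff R[i] R[i]^o)).
  apply: cvg_near_cst; exists m.+1 => // n /= mn.
  rewrite /S inner_suml (@big_cat_nat _ _ _ m.+1)//= big_nat_recr//=.
  rewrite big_nat big1 => [|j /andP[_ jm]]; last first.
    by rewrite innerZl oh (ltn_eqF jm) mulr0.
  rewrite big_nat big1 => [|j /andP[mj _]]; last first.
    by rewrite innerZl oh (gtn_eqF mj) mulr0.
  by rewrite innerZl oh eqxx hm mulr1 add0r addr0.
- apply: (subspace_lim CS (Sc x)) => n; apply: (subspace_sum CS) => m _.
  case: (Ch m) => [hm|->]; first exact: (subspaceZ CS).
  by rewrite scale0r; exact: (subspace0 CS).
Qed.
End Orthoseq.

(** * Orthonormal sequences in a separable space *)

Section Separable.
Context {R : realType} {H : hilbertType R}.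
Implicit Types (x y z : H) (k : R[i]).

Local Notation "''[' x , y ]" := (inner x y).

(** Distinct members of an orthonormal family are at distance [sqrt 2], so
    approximating each one within [1 / 2] by a point of a countable dense set
    is injective. *)
Lemma orthonormal_countable (T : Type) (X : set T) (v : T -> H) :
  separable H -> (forall s, X s -> '[v s, v s] = 1) ->
  (forall s t, X s -> X t -> s <> t -> '[v s, v t] = 0) -> countable X.
Proof.
move=> [D /countable_injP[f fD] Dd] v1 v0.
have near_D x : exists2 d, D d & `|x - d| < 1 / 2.
  have e0 : 0 < 1 / 2 :> R[i] by rewrite divr_gt0.
  have [|d [xd Dx]] := Dd (ball x (1 / 2))° _ (@open_interior _ _).
    by exists x; exact: nbhsx_ballx.
  by exists d => //; move: xd => /interior_subset; rewrite -ball_normE.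
have /choice[d dD] : forall s, exists d, D d /\ `|v s - d| < 1 / 2.
  by move=> s; have [d] := near_D (v s); exists d.
apply/countable_injP; exists (f \o d) => s t; rewrite !inE => Xs Xt /= fst.
have {}fst : d s = d t.
  by apply: fD => //; rewrite inE; [case: (dD s)|case: (dD t)].
apply: contrapT => st; have : `|v s - v t| < 1.
  rewrite -(subrKA (d s)) (le_lt_trans (ler_normD _ _))// [ltRHS]splitr ltrD//.
    by case: (dD s).
  by rewrite fst distrC; case: (dD t).
rewrite -(@ltr_pXn2r _ 2)// ?nnegrE// expr1n pythagoras.
  by rewrite normrN !sqr_norm_inner !v1// -subr_lt0 addrK ltr10.
by rewrite innerNr v0// oppr0.
Qed.

Lemma normalize x : x != 0 -> '[`|x|^-1 *: x, `|x|^-1 *: x] = 1.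
Proof.
move=> x0; rewrite -sqr_norm_inner normrZ normfV normr_id mulVf ?expr1n//.
by rewrite normr_eq0.
Qed.

(** A maximal orthonormal subset of [V] exists by Zorn's lemma, and it is
    countable. [V] need not be a subspace: taking the union of a family of
    mutually orthogonal subspaces produces a basis adapted to all of them. *)
Lemma maximal_orthoseq (V : set H) : separable H -> V 0 ->
  (forall k x, V x -> V (k *: x)) -> exists g : nat -> H,
  [/\ orthoseq g, forall m, V (g m) &
      forall x, V x -> (forall m, '[x, g m] = 0) -> x = 0].
Proof.
move=> Hsep V0 VZ.
pose P (S : set H) := S `<=` V /\
  forall s t, S s -> S t -> '[s, t] = (s == t)%:R.
have [F FP Ftot|S [[SV So] Smax]] := @Zorn_bigcup H P.
  split=> [x [X FX]|s t [X FX Xs] [Y FY Yt]]; first exact: (FP X FX).1.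
  have [XY|YX] := Ftot _ _ FX FY; first by apply: (FP Y FY).2 => //; exact: XY.
  by apply: (FP X FX).2 => //; exact: YX.
have /countable_injP[f fS] : countable S.
  apply: (@orthonormal_countable _ _ id) => // [s Ss|s t Ss St /eqP/negbTE st].
    by rewrite So// eqxx.
  by rewrite So// st.
pose g m := xget 0 [set s | S s /\ f s = m].
have gP m : g m = 0 \/ S (g m) /\ f (g m) = m.
  rewrite /g; case: xgetP => [s _ //|_]; [by right|by left].
have gf s : S s -> g (f s) = s.
  move=> Ss; rewrite /g; case: xgetP => [t _ /= [St tf]|/(_ s)/not_andP[]//].
  by apply: fS; rewrite ?inE.
have S0 : ~ S 0.
  move=> S0; have := So _ _ S0 S0; rewrite eqxx inner0l => /esym/eqP.
  by rewrite oner_eq0.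
exists g; split.
- move=> m j; have [->|[Sm fm]] := gP m; first by rewrite inner0l eqxx andbF.
  have gm0 : g m != 0 by apply/eqP => gm0; apply: S0; rewrite -gm0.
  rewrite gm0 andbT; have [gj0|[Sj fj]] := gP j.
    rewrite gj0 inner0r; case: eqP => // mj.
    by move: gm0; rewrite mj gj0 eqxx.
  rewrite So//; congr (_%:R); congr nat_of_bool; apply/eqP/eqP => [gmj|-> //].
  by rewrite -fm -fj gmj.
- by move=> m; have [->|[/SV]] := gP m.
- move=> x Vx xg; apply/eqP; apply: contraT => x0; exfalso.
  have xS s : S s -> '[x, s] = 0 by move=> Ss; rewrite -(gf s Ss).
  pose u := `|x|^-1 *: x.
  have uu : '[u, u] = 1 by exact: normalize.
  have uS s : S s -> '[u, s] = 0 by move=> Ss; rewrite innerZl xS// mulr0.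
  have nSu : ~ S u by move=> Su; move/eqP: uu; rewrite uS// eq_sym oner_eq0.
  apply: (Smax (S `|` [set u])).
    split; first exact: subsetUl.
    by move=> /(_ u) SuS; apply/nSu/SuS; right.
  split=> [s [/SV//|->]|s t]; first exact: VZ.
  have neq s' : S s' -> (s' == u) = false.
    by move=> Ss'; apply/eqP => su; apply: nSu; rewrite -su.
  move=> [Ss|->] [St|->]; first exact: So.
  + by rewrite (neq _ Ss) innerC uS// conjC0.
  + by rewrite eq_sym (neq _ St) uS.
  + by rewrite eqxx.
Qed.

Lemma orthogonal_subspace x : closed_subspace [set z | '[z, x] = 0].
Proof.
split; [split|] => /=.
- by rewrite inner0l.
- by move=> k y z yx zx; rewrite innerDl innerZl yx zx mulr0 addr0.
- by move=> y; exact: ortho_closure.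
Qed.

(** The projection is the partial isometry that fixes a maximal orthonormal
    sequence of [M]; it fixes all of [M] by maximality. *)
Lemma orthogonal_projection (M : set H) x : separable H -> closed_subspace M ->
  exists2 p, M p & forall y, M y -> '[x - p, y] = 0.
Proof.
move=> Hsep MS.
have [g [og Mg gmax]] := maximal_orthoseq Hsep (subspace0 MS) (subspaceZ MS).
have [P [_ Pg Psub]] := shift_op_ex og og.
have MP y : M (P y) by apply: Psub => // m; left.
have Pg' y m : '[y - P y, g m] = 0.
  have [->|gm] := eqVneq (g m) 0; first by rewrite inner0r.
  by rewrite innerBl Pg// subrr.
exists (P x) => // y My; apply: inner_eq0C.
have -> : y = P y.
  by apply/eqP; rewrite -subr_eq0; apply/eqP/gmax => //; exact: subspaceB.
apply: (Psub [set z | '[z, x - P x] = 0]); first exact: orthogonal_subspace.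
by move=> m; left; apply: inner_eq0C.
Qed.

Lemma exists_ominus (L M : set H) : separable H -> closed_subspace L ->
  closed_subspace M -> M `<` L -> exists2 x, ominus L M x & x != 0.
Proof.
move=> Hsep LS MS [ML nLM].
have [x [Lx nMx]] : exists x, L x /\ ~ M x.
  apply: contrapT => nex; apply: nLM => x Lx.
  by apply: contrapT => nMx; apply: nex; exists x.
have [p Mp xp] := orthogonal_projection x Hsep MS.
exists (x - p); first by split=> //; apply: (subspaceB LS) => //; exact: ML.
by apply/eqP => /subr0_eq xE; apply: nMx; rewrite xE.
Qed.

End Separable.

(** * Perturbation of the identity *)

Section Neumann.
Context {R : realType} {H : hilbertType R}.

(** The solution is the sum of the Neumann series [\sum_n D^n x], obtained as
    the limit of the iterates of [z |-> x + D z] from [0]. *)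
Lemma neumann_solution (D : bop H) (x : H) : `|D| < 1 -> exists y, y = x + D y.
Proof.
move=> D1; pose c := complex.Re `|D|.
have cE : c%:C = `|D| by rewrite RRe_real// ger0_real.
have c0 : 0 <= c by rewrite -lecR cE; exact: normr_ge0.
have c1 : c < 1 by rewrite -ltcR cE; exact: D1.
pose y n := iter n (fun z => x + D z) 0.
pose s n := complex.Re `|x| * series (geometric 1 c) n.
have xE : (complex.Re `|x|)%:C = `|x| by rewrite RRe_real// ger0_real.
have yS n : `|y n.+1 - y n| <= (complex.Re `|x| * c ^+ n)%:C.
  elim: n => [|n IH]; first by rewrite /y /= linear0 addr0 subr0 mulr1 xE.
  rewrite [y n.+2]iterS [y n.+1]iterS opprD addrACA subrr add0r -linearB.
  rewrite (le_trans (le_bop_normM _ _))// exprS mulrCA rmorphM/= cE.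
  by rewrite ler_wpM2l.
have yc : cvg (y @ \oo).
  apply: (@cvg_dominated _ _ _ s (complex.Re `|x| / (1 - c)) 1) => //.
    move=> n; rewrite /s geometric_seriesE ?lt_eqF//= mul1r ler_wpM2l//.
      by rewrite -lecR xE; exact: normr_ge0.
    by rewrite ler_piMl ?invr_ge0 ?subr_ge0 ?(ltW c1)// lerBlDr lerDl exprn_ge0.
  move=> p q; elim: q => [|q IH].
    by rewrite leqn0 => /eqP->; rewrite !subrr normr0 expr0n.
  rewrite leq_eqVlt => /predU1P[->|]; first by rewrite !subrr normr0 expr0n.
  rewrite ltnS => /IH; rewrite !expr1 => yqp.
  rewrite -(subrKA (y q)) (le_trans (ler_normD _ _))//.
  apply: (le_trans (lerD (yS q) yqp)); rewrite -rmorphD/= lecR.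
  by rewrite /s seriesSr /= mul1r mulrDr addrCA addrA lexx.
exists (lim (y @ \oo)); set l := lim _.
apply/eqP; rewrite -subr_eq0 -normr_le0; apply/ler_addgt0Pr => e e0.
rewrite add0r.
have e20 : 0 < e / 2 by rewrite divr_gt0.
have yle : \forall n \near \oo, `|l - y n| <= e / 2.
  exact: (@cvgr_dist_le _ _ _ _ _ y l yc _ e20).
have [N _ Ny] := yle.
rewrite -(subrKA (y N.+1)) [e]splitr (le_trans (ler_normD _ _))// lerD//.
  by apply: Ny => /=.
rewrite [y N.+1]iterS opprD addrACA subrr add0r -linearB.
rewrite (le_trans (le_bop_normM _ _))// distrC (le_trans _ (Ny N _))//=.
by rewrite ler_piMl// ltW.
Qed.
End Neumann.

(** * Rows that stay away from the one-sided invertible ones *)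

Section NestAlgebraFacts.
Context {R : realType} {H : hilbertType R} (N : nest H).
Implicit Types (x : H).

Lemma nest_closed_subspace M : nest_set N M -> closed_subspace M.
Proof.
by move=> NM; split; [exact: (nest_subspace NM)|exact: (nest_closed NM)].
Qed.

Lemma nest_alg_sub (T : nest_alg N) M x : nest_set N M -> M x -> M (T x).
Proof. by move=> NM Mx; apply: (nest_invariant NM); exists x. Qed.

Lemma bop_sumE n (F : 'I_n -> bop H) x : (\sum_i F i) x = \sum_i F i x.
Proof. by elim/big_rec2: _ => // i y T _ <-. Qed.

Lemma nest_alg_sumE n (F : 'I_n -> nest_alg N) x :
  (\sum_i F i) x = \sum_i F i x.
Proof. by elim/big_rec2: _ => // i y T _ <-. Qed.

Lemma nest_alg_distE (S T : nest_alg N) : `|S - T| = `|nest_bop S - nest_bop T|.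
Proof. by rewrite -[in RHS]scaleN1r -[in LHS]scaleN1r. Qed.

(** The radius [1 / (n + 1)] is chosen so that [n] errors of that size, each
    multiplied by a contraction, add up to less than [1]. *)
Lemma not_dense_row (n : nat) (A : banachAlgType R[i]) (S : set 'rV[A]_n)
    (a : 'rV[A]_n) :
  (forall a', S a' -> ~ forall i, `|a 0 i - a' 0 i| < n.+1%:R^-1) -> ~ dense S.
Proof.
move=> Sa Sd; have e0 : 0 < n.+1%:R^-1 :> R[i] by rewrite invr_gt0.
have [|a' [aa' Sa']] := Sd (ball a n.+1%:R^-1)° _ (@open_interior _ _).
  by exists a; exact: nbhsx_ballx.
apply: (Sa a' Sa') => i; have [_ /(_ 0 i)] := interior_subset aa'.
by rewrite -ball_normE.
Qed.
End NestAlgebraFacts.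

(** The common setting of both criteria is an interval [ominus L M] of the
    nest with an orthonormal basis [f], together with [n] disjoint injections
    [tau i] of the basis into itself that all miss some [p]. The isometries
    [v i : f m |-> f (tau i m)] of the interval have orthogonal ranges, and the
    [a i : f (tau i m) |-> f m] are their adjoints. The column of the [a i] is
    onto with the nonzero vector [f p] in its kernel; dually, the row of the
    [v i] is isometric and its range misses [f p]. Neither defect is removed by
    a small perturbation. *)
Section Rows.
Context {R : realType} {H : hilbertType R} (N : nest H).
Implicit Types (x y z : H).

Local Notation "''[' x , y ]" := (inner x y).

Context (Hsep : separable H) (L M : set H) (NL : nest_set N L)
  (NM : nest_set N M) (ML : M `<=` L).
Context (f : nat -> H) (f_ortho : orthoseq f)
  (f_ominus : forall m, ominus L M (f m))
  (f_total : forall x, ominus L M x -> (forall m, '[x, f m] = 0) -> x = 0).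
Context (n : nat) (tau : 'I_n -> nat -> nat) (p : nat)
  (tau_inj : forall i j m l, tau i m = tau j l -> i = j /\ m = l)
  (tau_neq0 : forall i m, f (tau i m) != 0)
  (fp_neq0 : f p != 0) (tau_neq : forall i m, tau i m != p).

Let LS := nest_closed_subspace NL.
Let MS := nest_closed_subspace NM.
Let KS : closed_subspace (ominus L M) := ominus_subspace M LS.

Let tau_ortho i : orthoseq (f \o tau i).
Proof.
move=> m j /=; rewrite f_ortho; congr ((_ && _)%:R).
by apply/eqP/eqP => [/tau_inj[]|->].
Qed.

(** On [L], being orthogonal to the basis of the interval means having zero
    compression to the interval, that is, lying in [M]. *)
Lemma ominus_total x : L x -> (forall m, '[x, f m] = 0) -> M x.
Proof.
move=> Lx xf; have [q Mq xq] := orthogonal_projection x Hsep MS.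
rewrite -[x](subrK q); apply: (subspaceD MS) => //.
rewrite (f_total (x := x - q)); first exact: (subspace0 MS).
  by split => //; apply: (subspaceB LS) => //; exact: ML.
move=> m; rewrite innerBl xf (inner_eq0C (_ : '[f m, q] = 0)) ?subr0//.
exact: (f_ominus m).2.
Qed.

Lemma isometries_ex : exists v : 'I_n -> bop H,
  [/\ forall i, `|v i| <= 1,
      forall i x m, '[v i x, f (tau i m)] = '[x, f m],
      forall i x, (forall m, '[x, f m] = 0) -> v i x = 0 &
      forall i (C : set H) x, closed_subspace C ->
        (forall m, C (f (tau i m)) \/ '[x, f m] = 0) -> C (v i x)].
Proof.
have [v vP] := choice (fun i => shift_op_ex f_ortho (tau_ortho i)).
exists v; split => [i|i x m|i x xf|i C x CS Cx].
- by have [vle _ _] := vP i; apply: opnorm_le => // x; rewrite mul1r.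
- by have [_ vf _] := vP i; apply: vf; exact: tau_neq0.
- have [_ _ vC] := vP i; apply: innerxx_eq0.
  by apply: (vC _ _ (orthogonal_subspace (v i x))) => m; right.
- by have [_ _ vC] := vP i; exact: vC.
Qed.

Lemma coisometries_ex : exists a : 'I_n -> bop H,
  [/\ forall i, `|a i| <= 1,
      forall i x m, f m != 0 -> '[a i x, f m] = '[x, f (tau i m)] &
      forall i (C : set H) x, closed_subspace C ->
        (forall m, C (f m) \/ '[x, f (tau i m)] = 0) -> C (a i x)].
Proof.
have [a aP] := choice (fun i => shift_op_ex (tau_ortho i) f_ortho).
exists a; split => [i|i x m|i C x CS Cx].
- by have [ale _ _] := aP i; apply: opnorm_le => // x; rewrite mul1r.
- by have [_ af _] := aP i; exact: af.
- by have [_ _ aC] := aP i; exact: aC.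
Qed.

Let sum_norm_lt1 (F G : 'I_n -> bop H) : (forall i, `|F i| <= 1) ->
  (forall i, `|G i| < n.+1%:R^-1) -> \sum_i `|F i| * `|G i| < 1.
Proof.
move=> F1 G1; rewrite (@le_lt_trans _ _ (\sum_(i < n) n.+1%:R^-1))//.
  by apply: ler_sum => i _; rewrite (le_trans (ler_piMl _ (F1 i)))// ltW.
rewrite sumr_const card_ord -[_ *+ _]mulr_natl ltr_pdivrMr// mul1r.
by rewrite ltr_nat.
Qed.

Section isometries.
Context (v : 'I_n -> bop H)
  (v_coef : forall i x m, '[v i x, f (tau i m)] = '[x, f m])
  (v_sub : forall i (C : set H) x, closed_subspace C ->
        (forall m, C (f (tau i m)) \/ '[x, f m] = 0) -> C (v i x)).

Lemma sum_isometries_coef (w : 'I_n -> H) i m :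
  '[\sum_j v j (w j), f (tau i m)] = '[w i, f m].
Proof.
rewrite inner_suml (bigD1 i)//= v_coef big1 ?addr0// => j ji.
apply: (@v_sub j [set z | '[z, f (tau i m)] = 0]) => [|l].
  exact: orthogonal_subspace.
left => /=; rewrite f_ortho; case: eqP => // /tau_inj[ji' _].
by rewrite ji' eqxx in ji.
Qed.

Lemma sum_isometries_ominus (w : 'I_n -> H) : ominus L M (\sum_j v j (w j)).
Proof. by apply: (subspace_sum KS) => i _; apply: v_sub => // m; left. Qed.

Lemma sum_isometries_ortho (w : 'I_n -> H) : '[\sum_j v j (w j), f p] = 0.
Proof.
rewrite inner_suml big1// => j _.
apply: (@v_sub j [set z | '[z, f p] = 0]) => [|l].
  exact: orthogonal_subspace.
by left; rewrite /= f_ortho (negbTE (tau_neq _ _)).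
Qed.
End isometries.

(** Suppose that [\sum_i b i * a' i = 1] with [a'] close to [a]. Then
    [D := \sum_i v i * (a i - a' i)] has norm less than [1], and the solution
    [y] of [y = f p + D y] lies in the interval. Comparing its coefficients on
    the [f (tau i m)] shows that every [a' i y] is orthogonal to the interval,
    hence lies in [M]; so does [y = \sum_i b i (a' i y)]. Thus [y = 0], and
    [f p = 0], which is absurd. *)
Lemma not_dense_Lg :
  (forall i m Q, nest_set N Q ->
    Q (f m) \/ forall z, Q z -> '[z, f (tau i m)] = 0) ->
  ~ dense (@Lg _ (nest_alg N) n).
Proof.
move=> rank1.
have [v [v1 v_coef _ v_sub]] := isometries_ex.
have [a [_ a_coef a_sub]] := coisometries_ex.
have aN i Q : nest_set N Q -> a i @` Q `<=` Q.
  move=> NQ _ [x Qx <-]; apply: a_sub; first exact: nest_closed_subspace NQ.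
  by move=> m; have [|Qf] := rank1 i m Q NQ; [left|right; exact: Qf].
apply: (@not_dense_row R n (nest_alg N) _ (\row_i NestAlg (@aN i))).
move=> a' [b ba'] aa'.
pose D : bop H := \sum_i bmul (v i) (a i - nest_bop (a' 0 i)).
have D1 : `|D| < 1.
  rewrite (le_lt_trans (ler_norm_sum _ _ _))//.
  apply: le_lt_trans
    (sum_norm_lt1 (F := v) (G := fun i => a i - nest_bop (a' 0 i)) _ _) => //.
    by apply: ler_sum => i _; exact: bmul_norm.
  by move=> i; have := aa' i; rewrite mxE nest_alg_distE.
have [y yE] := neumann_solution (f p) D1.
have DE : D y = \sum_i v i (a i y - a' 0 i y).
  by rewrite bop_sumE; apply: eq_bigr => i _ /=; rewrite scaleN1r.
have Ky : ominus L M y.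
  by rewrite yE DE; apply: (subspaceD KS) => //; exact: sum_isometries_ominus.
have a'M i : M (a' 0 i y).
  apply: ominus_total; first by apply: nest_alg_sub => //; case: Ky.
  move=> m; have [->|fm] := eqVneq (f m) 0; first by rewrite inner0r.
  have := congr1 (fun x => '[x, f (tau i m)]) yE.
  rewrite /= innerDl DE (sum_isometries_coef v_coef v_sub) innerBl a_coef//.
  rewrite f_ortho eq_sym (negbTE (tau_neq _ _)) add0r => /eqP.
  by rewrite -subr_eq0 opprB addrC subrK => /eqP.
have My : M y.
  have := congr1 (fun T : nest_alg N => T y) ba'.
  rewrite /= nest_alg_sumE => <-; apply: (subspace_sum MS) => i _ /=.
  by rewrite -[X in M X]/(b 0 i (a' 0 i y)); exact: nest_alg_sub.
have y0 : y = 0 by apply: innerxx_eq0; apply: Ky.2.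
by move: fp_neq0; rewrite y0 linear0 addr0 in yE; rewrite -yE eqxx.
Qed.

(** Suppose that [\sum_i v' i * b i = 1] with [v'] close to [v], and put
    [x := f p] and [y := \sum_i v i (b i x)]. Modulo [M], [a i y] is [b i x], so
    that [D := \sum_i (v i - v' i) * a i] satisfies [D y = (y - x) + r] with [r]
    in [M]. The three vectors [y], [x] and [r] are mutually orthogonal, hence
    [`|D y| > `|y|], while [`|D| < 1]. *)
Lemma not_dense_Rg :
  (forall i m Q, nest_set N Q ->
    Q (f (tau i m)) \/ forall z, Q z -> '[z, f m] = 0) ->
  ~ dense (@Rg _ (nest_alg N) n).
Proof.
move=> rank1.
have [v [_ v_coef v_eq0 v_sub]] := isometries_ex.
have [a [a1 a_coef a_sub]] := coisometries_ex.
have vN i Q : nest_set N Q -> v i @` Q `<=` Q.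
  move=> NQ _ [x Qx <-]; apply: v_sub; first exact: nest_closed_subspace NQ.
  by move=> m; have [|Qf] := rank1 i m Q NQ; [left|right; exact: Qf].
apply: (@not_dense_row R n (nest_alg N) _ (\row_i NestAlg (@vN i))).
move=> v' [b v'b] vv'.
pose D : bop H := \sum_i bmul (v i - nest_bop (v' 0 i)) (a i).
have D1 : `|D| < 1.
  rewrite (le_lt_trans (ler_norm_sum _ _ _))//.
  apply: le_lt_trans
    (sum_norm_lt1 (F := a) (G := fun i => v i - nest_bop (v' 0 i)) _ _) => //.
    by apply: ler_sum => i _; rewrite mulrC; exact: bmul_norm.
  by move=> i; have := vv' i; rewrite mxE nest_alg_distE.
pose x := f p; have Lx : L x by case: (f_ominus p).
pose y := \sum_i v i (b 0 i x).
have Ky : ominus L M y by exact: sum_isometries_ominus.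
pose z i := b 0 i x - a i y.
have Mz i : M (z i).
  apply: ominus_total.
    apply: (subspaceB LS); first exact: nest_alg_sub.
    by apply: a_sub => // m; left; case: (f_ominus m).
  move=> m; have [->|fm] := eqVneq (f m) 0; first by rewrite inner0r.
  by rewrite innerBl a_coef// (sum_isometries_coef v_coef v_sub) subrr.
have vz i : v i (z i) = 0.
  by apply: v_eq0 => m; apply: inner_eq0C; exact: (f_ominus m).2.
have ayE i : a i y = b 0 i x - z i by rewrite subKr.
clearbody z; pose r := \sum_i v' 0 i (z i).
have Mr : M r by apply: (subspace_sum MS) => i _; exact: nest_alg_sub.
have xE : x = \sum_i v' 0 i (b 0 i x).
  have := congr1 (fun T : nest_alg N => T x) v'b.
  by rewrite /= nest_alg_sumE => /esym.
have DE : D y = (y - x) + r.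
  rewrite [X in _ - X + _]xE -sumrB -big_split/= bop_sumE.
  apply: eq_bigr => i _ /=.
  by rewrite scaleN1r ayE !linearB /= vz subr0 opprK addrA.
have : `|D y| ^+ 2 <= `|y| ^+ 2.
  rewrite ler_pXn2r// ?nnegrE//.
  by rewrite (le_trans (le_bop_normM _ _))// ler_piMl// ltW.
rewrite DE pythagoras; last by rewrite innerBl Ky.2// (f_ominus p).2// subrr.
rewrite pythagoras; last by rewrite innerNr (sum_isometries_ortho v_sub) oppr0.
rewrite normrN -addrA gerDl => le0; have : 0 < `|x| ^+ 2 + `|r| ^+ 2.
  by rewrite ltr_wpDr ?exprn_ge0// exprn_gt0// normr_gt0.
by move=> /lt_le_trans /(_ le0); rewrite ltxx.
Qed.
End Rows.

(** A strictly increasing sequence [g] is built by choosing [g s] above the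
    earlier values and above [p], in relation with the quotient [s %/ n]; the
    [n] indices [m * n + i] then provide the [n] images of [m]. *)
Lemma greedy_family (r : nat -> nat -> Prop) (n p : nat) : (0 < n)%N ->
  (forall m b, exists2 q, (b < q)%N & r m q) ->
  exists tau : 'I_n -> nat -> nat,
  [/\ forall i j m l, tau i m = tau j l -> i = j /\ m = l,
      forall i m, r m (tau i m) & forall i m, tau i m != p].
Proof.
move=> n0 rex.
have /choice[e eP] : forall mb : nat * nat, exists q, (mb.2 < q)%N /\ r mb.1 q.
  by move=> [m b]; have [q] := rex m b; exists q.
pose fix g s := if s is s'.+1 then e (s %/ n, g s')%N else e (0%N, p).
have gS s : (g s < g s.+1)%N by case: (eP (s.+1 %/ n, g s)%N).
have gr s : r (s %/ n)%N (g s).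
  case: s => [|s]; last by case: (eP (s.+1 %/ n, g s)%N).
  by rewrite div0n; case: (eP (0%N, p)).
have g_mono : {mono g : s t / (s <= t)%N}.
  by apply: leq_mono; apply: homo_ltn => //; exact: ltn_trans.
have g_inj : injective g by apply: incn_inj.
exists (fun i m => g (m * n + i)%N); split=> [i j m l /g_inj E|i m|i m].
- have ml : m = l.
    have := congr1 (divn^~ n) E.
    by rewrite !divnMDl// !divn_small// !addn0.
  by split=> //; apply/val_inj; move: E; rewrite ml => /addnI.
- by have := gr (m * n + i)%N; rewrite divnMDl// divn_small// addn0.
- rewrite gtn_eqF//; apply: (@leq_trans (g 0%N)); last by rewrite g_mono.
  by case: (eP (0%N, p)).
Qed.

(** * Intervals of a nest with infinite stable rank *)

Section Intervals.
Context {R : realType} {H : hilbertType R} (N : nest H) (Hsep : separable H).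
Implicit Types (x y z : H) (L M Q : set H).

Local Notation "''[' x , y ]" := (inner x y).

Lemma least_pos_oo (P : nat -> Prop) :
  (forall n, (0 < n)%N -> ~ P n) -> least_pos P = +oo%E.
Proof.
move=> nP; rewrite /least_pos; case: pselect => // ex; exfalso.
by have [n /andP[n0 /asboolP]] := ex; exact: nP.
Qed.

(** This says that the operator [z |-> '[z, y] *: x] leaves every member of the
    nest invariant. *)
Definition rank_one_in x y :=
  forall Q, nest_set N Q -> Q x \/ forall z, Q z -> '[z, y] = 0.

Section interval.
Context (L M : set H) (NL : nest_set N L) (NM : nest_set N M) (ML : M `<=` L).
Context (f : nat -> H) (f_ortho : orthoseq f)
  (f_ominus : forall m, ominus L M (f m))
  (f_total : forall x, ominus L M x -> (forall m, '[x, f m] = 0) -> x = 0).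

Lemma ltsr_interval :
  (forall m b, exists2 q, (b < q)%N & f q != 0 /\ rank_one_in (f m) (f q)) ->
  ltsr (nest_alg N) = +oo%E.
Proof.
move=> fr; have [p _ [fp _]] := fr 0%N 0%N.
apply: least_pos_oo => n n0; have [tau [tinj tr tp]] := greedy_family p n0 fr.
apply: (not_dense_Lg Hsep NL NM ML f_ortho f_ominus f_total tinj _ fp tp).
  by move=> i m; case: (tr i m).
by move=> i m; case: (tr i m).
Qed.

Lemma rtsr_interval :
  (forall m b, exists2 q, (b < q)%N & f q != 0 /\ rank_one_in (f q) (f m)) ->
  rtsr (nest_alg N) = +oo%E.
Proof.
move=> fr; have [p _ [fp _]] := fr 0%N 0%N.
apply: least_pos_oo => n n0; have [tau [tinj tr tp]] := greedy_family p n0 fr.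
apply: (not_dense_Rg Hsep NL NM ML f_ortho f_ominus f_total tinj _ fp tp).
  by move=> i m; case: (tr i m).
by move=> i m; case: (tr i m).
Qed.
End interval.

(** No member of the nest lies strictly inside the interval, so every rank-one
    operator on it belongs to the algebra. *)
Lemma tsr_infinite_atom E : atom N E -> ~ finite_dim E ->
  ltsr (nest_alg N) = +oo%E /\ rtsr (nest_alg N) = +oo%E.
Proof.
move=> [M [NM _ ->]] nfin; set L := nest_succ N M in nfin *.
have NL : nest_set N L by apply: nest_bigcap => Q [].
have ML : M `<=` L by move=> x Mx Q [_ [MQ _]]; exact: MQ.
have ES : closed_subspace (ominus L M).
  by apply: ominus_subspace; exact: nest_closed_subspace NL.
have [g [og Eg gmax]] := maximal_orthoseq Hsep (subspace0 ES) (subspaceZ ES).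
have ginf b : exists2 q, (b < q)%N & g q != 0.
  apply: contrapT => gb; apply: nfin.
  have {}gb q : (b < q)%N -> g q = 0.
    by move=> bq; apply/eqP; apply: contrapT => /negP gq; apply: gb; exists q.
  exists (g @` `I_b.+1); first exact: finite_image.
  apply/seteqP; split=> [x Ex|_ [n [k [v [gv ->]]]]]; last first.
    apply: (subspace_sum ES) => i _; apply: (subspaceZ ES).
    by have [j _ <-] := gv i.
  exists b.+1, (fun i => '[x, g i]), g; split=> [i|]; first by exists i => /=.
  apply/eqP; rewrite -subr_eq0; apply/eqP/gmax => [|m].
    apply: (subspaceB ES) => //; apply: (subspace_sum ES) => i _.
    exact: (subspaceZ ES).
  have [mb|bm] := leqP m b; last by rewrite gb// inner0r.
  rewrite innerBl inner_suml (bigD1 (Ordinal (mb : (m < b.+1)%N)))//= innerZl.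
  rewrite inner_orthoseqK// big1 ?addr0 ?subrr// => i.
  rewrite -val_eqE /= => im.
  by rewrite innerZl og (negbTE im) mulr0.
have gr m q : rank_one_in (g m) (g q).
  move=> Q NQ; have [QM|nQM] := pselect (Q `<=` M).
    by right=> z /QM Mz; apply: inner_eq0C; exact: (Eg q).2.
  left; have [Lgm _] := Eg m; apply: Lgm; split=> //; split=> //.
  by have [] := nest_chain NM NQ.
split; [apply: (ltsr_interval NL NM ML og Eg gmax)|
        apply: (rtsr_interval NL NM ML og Eg gmax)] => m b;
  by have [q bq gq] := ginf b; exists q.
Qed.

(** A maximal orthonormal sequence in the union of the [E k] is graded by
    [kappa]. By maximality every degree occurs among its nonzero terms, so large
    degrees occur arbitrarily far in the sequence. *)
Lemma graded_orthoseq (E : nat -> set H) :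
  (forall k, closed_subspace (E k)) ->
  (forall j k x y, (j < k)%N -> E j x -> E k y -> '[x, y] = 0) ->
  (forall k, exists2 x, E k x & x != 0) ->
  exists (g : nat -> H) (kappa : nat -> nat),
  [/\ orthoseq g, forall m, E (kappa m) (g m),
      forall k x, E k x -> (forall m, '[x, g m] = 0) -> x = 0 &
      forall m b, exists2 q, (b < q)%N & g q != 0 /\ (kappa m < kappa q)%N].
Proof.
move=> ES E_lt Ene.
have E_neq j k x y : j != k -> E j x -> E k y -> '[x, y] = 0.
  rewrite neq_ltn => /orP[jk|kj] Ex Ey; first exact: E_lt jk Ex Ey.
  by apply: inner_eq0C; exact: E_lt kj Ey Ex.
have [|k x [j _ Ejx]|g [og Eg gmax]] :=
  @maximal_orthoseq _ _ (\bigcup_k E k) Hsep.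
- by exists 0%N => //; exact: (subspace0 (ES _)).
- by exists j => //; exact: (subspaceZ (ES _)).
have /choice[kappa kP] : forall m, exists k, E k (g m).
  by move=> m; have [k] := Eg m; exists k.
exists g, kappa; split=> // [k x Ex|m b]; first by apply: gmax; exists k.
(* A degree larger than [kappa m] and than those of the first [b.+1] terms. *)
pose k := (kappa m + \sum_(j < b.+1) kappa j).+1.
have [x Ex x0] := Ene k.
have [q xq] : exists q, '[x, g q] != 0.
  apply: contrapT => nq; move/eqP: x0; apply; apply: gmax; first by exists k.
  by move=> q; apply/eqP; apply: contrapT => /negP xq; apply: nq; exists q.
have kq : kappa q = k.
  apply/eqP; apply: contraTT xq => kq; rewrite negbK.
  by apply/eqP; apply: (E_neq k (kappa q)) => //; rewrite eq_sym.
exists q; last split.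
- rewrite ltnNge; apply/negP => qb.
  have : (kappa q <= \sum_(j < b.+1) kappa j)%N.
    by rewrite (bigD1 (Ordinal (qb : (q < b.+1)%N)))//= leq_addr.
  by rewrite kq /k leqNgt ltnS leq_addl.
- by apply: contraNneq xq => ->; rewrite inner0r.
- by rewrite kq /k ltnS leq_addr.
Qed.

(** Take for [L] the closed span of all the [F k], and for [M] the first one.
    The rank-one operators taking [g q] to [g m] belong to the algebra when [q]
    has larger degree than [m], so the coisometries of the criterion can be
    taken in it: they shift the graded basis down. *)
Lemma ltsr_increasing (F : nat -> set H) : (forall k, nest_set N (F k)) ->
  (forall k, F k `<` F k.+1) -> ltsr (nest_alg N) = +oo%E.
Proof.
move=> NF Flt; have FS k := nest_closed_subspace (NF k).
have Fle j k : (j <= k)%N -> F j `<=` F k.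
  elim: k => [|k IH]; first by rewrite leqn0 => /eqP->.
  rewrite leq_eqVlt => /predU1P[->//|/IH jk].
  exact: subset_trans jk (Flt k).1.
pose E k := ominus (F k.+1) (F k).
have [|j k x y jk [Fx _] [_ yF]|k|g [kappa [og Eg gmax gk]]] :=
  @graded_orthoseq E.
- by move=> k; exact: ominus_subspace.
- by apply: inner_eq0C; apply: yF; exact: Fle Fx.
- exact: exists_ominus.
have NL : nest_set N (closure (linspan (\bigcup_(Q in range F) Q))).
  by apply: nest_bigspan => _ [k _ <-].
set L := closure _ in NL.
have FL k : F k `<=` L.
  move=> x Fx; apply: subset_closure; exists 1%N, (fun=> 1), (fun=> x).
  by split; [move=> _; exists (F k) => //; exists k | rewrite big_ord1 scale1r].
apply: (ltsr_interval NL (NF 0%N) (FL 0%N) og) => [m|x [Lx xF0] xg|m b].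
- have [Fg gF] := Eg m; split; first exact: FL Fg.
  by move=> y F0y; apply: gF; exact: Fle F0y.
- (* [x] is orthogonal to [F k] for all [k]: its projection [q] on [F k.+1]
     lies in [E k] and is orthogonal to every [g m]. *)
  have xF k y : F k y -> '[x, y] = 0.
    elim: k y => [|k IH y Fy]; first exact: xF0.
    have [q Fq xq] := orthogonal_projection x Hsep (FS k.+1).
    suff q0 : q = 0 by have := xq y Fy; rewrite q0 subr0.
    apply: (gmax k) => [|m].
      split=> // z Fz.
      have /eqP := xq z ((Flt k).1 z Fz).
      by rewrite innerBl IH// sub0r oppr_eq0 => /eqP.
    have [Fg gF] := Eg m.
    have [mk|km] := leqP (kappa m) k; last first.
      by apply: inner_eq0C; apply: gF; exact: Fle km _ Fq.
    have /eqP := xq (g m) (Fle (kappa m).+1 k.+1 mk _ Fg).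
    by rewrite innerBl xg sub0r oppr_eq0 => /eqP.
  apply: innerxx_eq0; apply: ortho_closure Lx => _ [n [k [v [Fv ->]]]].
  rewrite inner_suml big1// => i _; have [_ [j _ <-] Fvi] := Fv i.
  by rewrite innerZl (inner_eq0C (xF _ _ Fvi)) mulr0.
- have [q bq [gq mq]] := gk m b; exists q => //; split=> // Q NQ.
  have [Fg gF] := Eg m; have [_ gqF] := Eg q.
  have [QF|FQ] := nest_chain NQ (NF (kappa q)).
    by right=> z /QF Fz; apply: inner_eq0C; exact: gqF.
  by left; apply: FQ; exact: Fle mq _ Fg.
Qed.

(** Take for [M] the intersection of the [F k], and for [L] the first one. Here
    the rank-one operators that raise the degree belong to the algebra, and with
    them the isometries of the criterion. *)
Lemma rtsr_decreasing (F : nat -> set H) : (forall k, nest_set N (F k)) ->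
  (forall k, F k.+1 `<` F k) -> rtsr (nest_alg N) = +oo%E.
Proof.
move=> NF Flt; have FS k := nest_closed_subspace (NF k).
have Fle j k : (j <= k)%N -> F k `<=` F j.
  elim: k => [|k IH]; first by rewrite leqn0 => /eqP->.
  rewrite leq_eqVlt => /predU1P[->//|/IH jk].
  exact: subset_trans (Flt k).1 jk.
pose E k := ominus (F k) (F k.+1).
have [|j k x y jk [_ xF] [Fy _]|k|g [kappa [og Eg gmax gk]]] :=
  @graded_orthoseq E.
- by move=> k; exact: ominus_subspace.
- by apply: xF; exact: Fle Fy.
- exact: exists_ominus.
have NM : nest_set N (\bigcap_(Q in range F) Q).
  by apply: nest_bigcap => _ [k _ <-].
set M := \bigcap_(_ in _) _ in NM.
have MF k : M `<=` F k by move=> x; apply; exists k.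
apply: (rtsr_interval (NF 0%N) NM (MF 0%N) og) => [m|x [F0x xM] xg|m b].
- have [Fg gF] := Eg m; split; first exact: Fle Fg.
  by move=> y My; apply: gF; exact: MF My.
- (* [x] lies in every [F k]: its component orthogonal to [F k.+1] is in [E k]
     and orthogonal to every [g m]. *)
  suff xF k : F k x by apply: innerxx_eq0; apply: xM => _ [k _ <-].
  elim: k => // k Fx; have [q Fq xq] := orthogonal_projection x Hsep (FS k.+1).
  suff /subr0_eq-> : x - q = 0 by [].
  apply: (gmax k) => [|m].
    by split=> //; apply: (subspaceB (FS k)) => //; exact: (Flt k).1.
  have [Fg gF] := Eg m; have [mk|km] := leqP (kappa m) k; last first.
    by apply: xq; exact: Fle km _ Fg.
  rewrite innerBl xg sub0r; apply/eqP; rewrite oppr_eq0; apply/eqP.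
  by apply: inner_eq0C; apply: gF; exact: Fle Fq.
- have [q bq [gq mq]] := gk m b; exists q => //; split=> // Q NQ.
  have [_ gF] := Eg m; have [Fgq _] := Eg q.
  have [QF|FQ] := nest_chain NQ (NF (kappa m).+1).
    by right=> z /QF Fz; apply: inner_eq0C; exact: gF.
  by left; apply: FQ; exact: Fle mq _ Fgq.
Qed.
End Intervals.

(** * Well-ordered nests *)

Lemma countable_setD1 (T : Type) (A : set T) (x : T) :
  countable (A `\ x) -> countable A.
Proof.
move=> Ax; apply: (@sub_countable _ _ _ (\bigcup_i bigcup2 (A `\ x) [set x] i)).
  apply: subset_card_le => y Ay; rewrite bigcup2E.
  by have [->|yx] := pselect (y = x); [right|left].
by apply: bigcup_countable => // -[|[|i]] _ /=.
Qed.

Section NestOrder.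
Context {R : realType} {H : hilbertType R} (N : nest H).
Implicit Types (L M Q : set H).

Local Notation "''[' x , y ]" := (inner x y).

Record nest_elt := NestElt {
  nest_elt_set :> set H;
  nest_eltP : nest_set N nest_elt_set }.

HB.instance Definition _ := gen_eqMixin nest_elt.
HB.instance Definition _ := gen_choiceMixin nest_elt.

Lemma nest_elt_inj : injective nest_elt_set.
Proof.
move=> [L NL] [M NM] /= LM; subst M.
by congr NestElt; exact: Prop_irrelevance.
Qed.

Definition nest_elt_le (A B : nest_elt) := `[< A `<=` B >].

Let le_refl : reflexive nest_elt_le.
Proof. by move=> A; apply/asboolP. Qed.
Let le_anti : antisymmetric nest_elt_le.
Proof.
move=> A B /andP[/asboolP AB /asboolP BA].
by apply: nest_elt_inj; exact/seteqP.
Qed.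
Let le_trans : transitive nest_elt_le.
Proof.
by move=> B A C /asboolP AB /asboolP BC; apply/asboolP; exact: subset_trans BC.
Qed.
Let le_total : total nest_elt_le.
Proof.
move=> A B; apply/orP.
by have [AB|BA] := nest_chain (nest_eltP A) (nest_eltP B);
  [left|right]; apply/asboolP.
Qed.

HB.instance Definition _ :=
  Order.Le_isPOrder.Build (Order.Disp tt tt) nest_elt le_refl
    le_anti le_trans.
HB.instance Definition _ :=
  Order.POrder_isTotal.Build (Order.Disp tt tt) nest_elt le_total.

Definition to_nest_elt L : nest_elt :=
  if pselect (nest_set N L) is left NL then NestElt NL else NestElt (nest0 N).

Lemma to_nest_eltK L : nest_set N L -> to_nest_elt L = L :> set H.
Proof. by rewrite /to_nest_elt; case: pselect. Qed.

Lemma to_nest_elt_bij : set_bij (nest_set N) setT to_nest_elt.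
Proof.
split=> //.
- move=> L M; rewrite !inE => NL NM LM.
  by rewrite -(to_nest_eltK NL) LM to_nest_eltK.
- move=> A _; exists (A : set H); first exact: nest_eltP.
  by apply: nest_elt_inj; rewrite to_nest_eltK//; exact: nest_eltP.
Qed.

Lemma to_nest_elt_le L M : nest_set N L -> nest_set N M ->
  (L `<=` M <-> (to_nest_elt L <= to_nest_elt M)%O).
Proof.
move=> NL NM; rewrite -{1}(to_nest_eltK NL) -{1}(to_nest_eltK NM).
by split=> [LM|/asboolP//]; apply/asboolP.
Qed.

Definition well_ordered_nest := forall Y : set (set H), Y `<=` nest_set N ->
  Y !=set0 -> exists2 M, Y M & forall Q, Y Q -> M `<=` Q.

Definition dually_well_ordered_nest :=
  forall Y : set (set H), Y `<=` nest_set N -> Y !=set0 ->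
  exists2 M, Y M & forall Q, Y Q -> Q `<=` M.

Lemma well_ordered_nest_ordinal : well_ordered_nest -> iso_ordinal N.
Proof.
move=> wf; exists _, nest_elt; split; last first.
  by exists to_nest_elt; [exact: to_nest_elt_bij|exact: to_nest_elt_le].
apply: wochoice.antisymmetric_well_order.
  exact: Order.POrderTheory.le_anti.
move=> A [a Aa].
have [||M [B AB <-] Mle] := wf (nest_elt_set @` [set B | B \in A]).
- by move=> _ [B _ <-]; exact: nest_eltP.
- by exists a, a.
- exists B; split=> // C AC; apply/asboolP; apply: Mle.
  by exists C.
Qed.

(** The well-ordered type is the reversed nest. Its dual carries the original
    relation up to conversion, so the same bijection serves. *)
Lemma dually_well_ordered_nest_ordinal :
  dually_well_ordered_nest -> iso_dual_ordinal N.
Proof.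
move=> wf; exists _, (nest_elt^d)%type; split; last first.
  by exists to_nest_elt; [exact: to_nest_elt_bij|exact: to_nest_elt_le].
apply: wochoice.antisymmetric_well_order.
  exact: Order.POrderTheory.le_anti.
move=> A [a Aa].
have [||M [B AB <-] Mle] := wf (nest_elt_set @` [set B | B \in A]).
- by move=> _ [B _ <-]; exact: nest_eltP.
- by exists a, a.
- exists B; split=> // C AC; apply/asboolP; apply: Mle.
  by exists C.
Qed.

Lemma endless_chain (Y : set (set H)) (r : set H -> set H -> Prop) :
  Y !=set0 -> (forall M, Y M -> exists2 Q, Y Q & r M Q) ->
  exists2 F : nat -> set H, forall k, Y (F k) & forall k, r (F k) (F k.+1).
Proof.
move=> [M0 YM0] Yr.
have /choice[f fP] : forall M, exists Q, Y M -> Y Q /\ r M Q.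
  move=> M.
  have [/Yr[Q YQ rQ]|nYM] := pselect (Y M); first by exists Q.
  by exists M.
pose F k := iter k f M0.
have YF k : Y (F k) by elim: k => //= k /fP[].
by exists F => // k; have [] := fP _ (YF k).
Qed.

Lemma decreasing_sequence : ~ well_ordered_nest ->
  exists2 F : nat -> set H, forall k, nest_set N (F k) &
    forall k, F k.+1 `<` F k.
Proof.
move=> /existsNP[Y /not_implyP[YN /not_implyP[Y0 nY]]].
have [M YM|F YF Flt] := @endless_chain Y (fun M Q => Q `<` M) Y0.
  apply: contrapT => nQ; apply: nY; exists M => // Q YQ.
  have [//|QM] := nest_chain (YN _ YM) (YN _ YQ).
  by apply: contrapT => nMQ; apply: nQ; exists Q.
by exists F => // k; exact: YN.
Qed.

Lemma increasing_sequence : ~ dually_well_ordered_nest ->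
  exists2 F : nat -> set H, forall k, nest_set N (F k) &
    forall k, F k `<` F k.+1.
Proof.
move=> /existsNP[Y /not_implyP[YN /not_implyP[Y0 nY]]].
have [M YM|F YF Flt] := @endless_chain Y (fun M Q => M `<` Q) Y0.
  apply: contrapT => nQ; apply: nY; exists M => // Q YQ.
  have [//|MQ] := nest_chain (YN _ YQ) (YN _ YM).
  by apply: contrapT => nMQ; apply: nQ; exists Q.
by exists F => // k; exact: YN.
Qed.

Context (Hsep : separable H).

Lemma unit_ominus L M : nest_set N L -> nest_set N M -> M `<` L ->
  exists2 x, ominus L M x & '[x, x] = 1.
Proof.
move=> NL NM ML; have LS := nest_closed_subspace NL.
have [x Kx x0] := exists_ominus Hsep LS (nest_closed_subspace NM) ML.
exists (`|x|^-1 *: x); last exact: normalize.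
exact: (subspaceZ (ominus_subspace M LS)).
Qed.

(** Each member other than the whole space has an immediate successor. A unit
    vector of each gap so obtained gives an orthonormal family. *)
Lemma well_ordered_nest_countable :
  well_ordered_nest -> countable (nest_set N).
Proof.
move=> wf; pose X := nest_set N `\ [set: H].
have /choice[u uP] : forall M, exists x, X M -> [/\ '[x, x] = 1,
    forall y, M y -> '[x, y] = 0 & forall Q, nest_set N Q -> M `<` Q -> Q x].
  move=> M.
  have [[NM MT]|nXM] := pselect (X M); last by exists 0.
  have [||L [NL ML] Lmin] := wf [set Q | nest_set N Q /\ M `<` Q].
  - by move=> Q [].
  - exists setT; split; first exact: nestT.
    by split=> // TM; apply: MT; apply/seteqP.
  - have [x [Lx xM] x1] := unit_ominus NL NM ML.
    by exists x => _; split=> // Q NQ MQ; apply: Lmin.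
have Xc : countable X.
  apply: (@orthonormal_countable _ _ _ _ u) => // [M /uP[]//|L M XL XM LM].
  wlog LleM : L M XL XM LM / L `<=` M => [wl|].
    have [|ML] := nest_chain XL.1 XM.1; first exact: wl.
    by apply: inner_eq0C; apply: wl => // /esym.
  have [_ _ uL] := uP L XL; have [_ uM _] := uP M XM.
  apply: inner_eq0C; apply: uM; apply: uL; first exact: XM.1.
  by split=> // ML; apply: LM; apply/seteqP.
exact: countable_setD1 Xc.
Qed.

(** The same argument with the gap below each nonzero member. *)
Lemma dually_well_ordered_nest_countable :
  dually_well_ordered_nest -> countable (nest_set N).
Proof.
move=> wf; pose X := nest_set N `\ [set (0 : H)].
have /choice[u uP] : forall M, exists x, X M -> [/\ '[x, x] = 1,
    M x & forall Q, nest_set N Q -> Q `<` M -> forall y, Q y -> '[x, y] = 0].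
  move=> M.
  have [[NM M0]|nXM] := pselect (X M); last by exists 0.
  have [||L [NL ML] Lmax] := wf [set Q | nest_set N Q /\ Q `<` M].
  - by move=> Q [].
  - have M00 := subspace0 (nest_closed_subspace NM).
    exists [set 0]; split; first exact: nest0.
    split=> [x ->//|MO]; apply: M0; apply/seteqP; split=> // x ->.
    exact: M00.
  - have [x [Mx xL] x1] := unit_ominus NM NL ML.
    by exists x => _; split=> // Q NQ QM y Qy; apply: xL; apply: Lmax Qy.
have Xc : countable X.
  apply: (@orthonormal_countable _ _ _ _ u) => // [M /uP[]//|L M XL XM LM].
  wlog LleM : L M XL XM LM / L `<=` M => [wl|].
    have [|ML] := nest_chain XL.1 XM.1; first exact: wl.
    by apply: inner_eq0C; apply: wl => // /esym.
  have [_ Lu _] := uP L XL; have [_ _ uM] := uP M XM.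
  apply: inner_eq0C; apply: (uM L) => //; first exact: XL.1.
  by split=> // ML; apply: LM; apply/seteqP.
exact: countable_setD1 Xc.
Qed.
End NestOrder.

Theorem theorem2p4 (R : realType) (H : hilbertType R) (N : nest H)
    (Hinf : ~ finite_dim [set: H]) (Hsep : separable H)
    (HN : (exists2 E, atom N E & ~ finite_dim E) \/
          ~ countable (nest_set N) \/
          (countable (nest_set N) /\ ~ (iso_ordinal N \/ iso_dual_ordinal N))) :
  ltsr (nest_alg N) = +oo%E /\ rtsr (nest_alg N) = +oo%E.
Proof.
case: HN => [[E NE Einf]|HN]; first exact: tsr_infinite_atom NE Einf.
have nup : ~ well_ordered_nest N.
  move=> wf; case: HN => [|[_]]; apply.
    exact: well_ordered_nest_countable.
  by left; exact: well_ordered_nest_ordinal.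
have ndown : ~ dually_well_ordered_nest N.
  move=> wf; case: HN => [|[_]]; apply.
    exact: dually_well_ordered_nest_countable.
  by right; exact: dually_well_ordered_nest_ordinal.
split.
  have [F NF Flt] := increasing_sequence ndown.
  exact: ltsr_increasing Flt.
have [F NF Flt] := decreasing_sequence nup.
exact: rtsr_decreasing Flt.
Qed.
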